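(* Let $A$ and $B$ be $C^*$-algebras and let ${}_AX_B$ be an $A$--$B$ imprimitivity bimodule. Let $\pi\in\hat B$ and let $(\pi_\alpha)$ be a net in $\hat B$ such that $\pi$ is a cluster point of $(\pi_\alpha)$. Then $$M_U(\pi,(\pi_\alpha))=M_U\big(X\text{-}\mathrm{Ind}\,\pi,\,(X\text{-}\mathrm{Ind}\,\pi_\alpha)\big),$$ where the left-hand side is computed in $\hat B$ and the right-hand side in $\hat A$.
   Context: Imprimitivity bimodules: an $A$--$B$ imprimitivity bimodule ${}_AX_B$ is an $A$--$B$ bimodule which is a full left Hilbert $A$-module (inner product ${}_A\langle\cdot,\cdot\rangle$) and a full right Hilbert $B$-module (inner product $\langle\cdot,\cdot\rangle_B$), such that $A$ acts by adjointable operators on $X_B$, $B$ acts by adjointable operators on ${}_AX$, and ${}_A\langle x,y\rangle\cdot z=x\cdot\langle y,z\rangle_B$. For a representation $\pi$ of $B$ on $H$, $X\text{-}\mathrm{Ind}\,\pi$ (also written $\mathrm{Ind}\,\pi$) is the representation of $A$ on $X\otimes_BH$ (the Hilbert space completion of the balanced tensor product with $(x\otimes h\,|\,y\otimes k)=(\pi(\langle y,x\rangle_B)h\,|\,k)$) given by $\mathrm{Ind}\,\pi(a)(x\otimes h)=(a\cdot x)\otimes h$. Induction respects unitary equivalence and irreducibility and induces a homeomorphism of the spectrum $\hat B$ onto $\hat A$. Upper multiplicity relative to a net (Archbold, Archbold--Spielberg): let $D$ be a $C^*$-algebra, $\pi\in\hat D$, and let $\varphi$ be a pure state of $D$ associated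 with $\pi$ (a vector state of $\pi$). Let $\mathcal N$ be the set of weak*-open neighbourhoods of $0$ in $D^*$. For $N\in\mathcal N$ and $\sigma\in\hat D$ put $\mathrm{Vec}(\sigma,\varphi,N)=\{\eta\in H_\sigma:\|\eta\|=1,\ (\sigma(\cdot)\eta\,|\,\eta)\in\varphi+N\}$, and let $d(\sigma,\varphi,N)\in\{0,1,2,\dots\}\cup\{\infty\}$ be the supremum of the cardinalities of finite orthonormal subsets of $\mathrm{Vec}(\sigma,\varphi,N)$ (equal to $0$ if this set is empty). For a net $(\pi_\alpha)$ in $\hat D$, $$M_U(\pi,(\pi_\alpha))=\inf_{N\in\mathcal N}\ \limsup_\alpha d(\pi_\alpha,\varphi,N),$$ which is independent of the choice of $\varphi$. *)

(* Defs.v *)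
(* The complex field is R[i], for an arbitrary R : realType. *)
From HB Require Import structures.
From mathcomp Require Import all_boot all_order all_algebra.
From mathcomp Require Import all_classical all_reals all_analysis.
From mathcomp Require Import complex.

Set Implicit Arguments.
Unset Strict Implicit.
Unset Printing Implicit Defensive.

Import Order.TTheory GRing.Theory Num.Theory.
Import numFieldNormedType.Exports.

Local Open Scope classical_set_scope.
Local Open Scope ring_scope.

HB.mixin Record isCStarAlgebra (R : realType) A of CompleteNormedModule R[i] A := {
  cmul : A -> A -> A;
  cstar : A -> A;
  cmulA : associative cmul;
  cmul_linearl : forall b, linear (cmul ^~ b);
  cmul_linearr : forall a, linear (cmul a);
  cstarD : forall a b, cstar (a + b) = cstar a + cstar b;
  cstarZ : forall (l : R[i]) a, cstar (l *: a) = l^* *: cstar a;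
  cstarK : involutive cstar;
  cstarM : forall a b, cstar (cmul a b) = cmul (cstar b) (cstar a);
  cmul_norm : forall a b, `|cmul a b| <= `|a| * `|b|;
  cstar_norm : forall a, `|cmul (cstar a) a| = `|a| ^+ 2
}.

#[short(type="cstarAlgType")]
HB.structure Definition CStarAlgebra (R : realType) :=
  { A of isCStarAlgebra R A & CompleteNormedModule R[i] A }.

(* The inner product is linear in the first variable. *)
HB.mixin Record isHilbertSpace (R : realType) H of CompleteNormedModule R[i] H := {
  hip : H -> H -> R[i];
  hip_scalar : forall k, scalar (hip ^~ k);
  hip_conj : forall h k, hip h k = (hip k h)^*;
  hip_norm : forall h, hip h h = `|h| ^+ 2
}.

#[short(type="hilbertType")]
HB.structure Definition HilbertSpace (R : realType) :=
  { H of isHilbertSpace R H & CompleteNormedModule R[i] H }.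

Section Representations.
Context {R : realType} {D : cstarAlgType R}.

Record representation (H : hilbertType R) := Representation {
  rep :> D -> H -> H;
  rep_continuous : forall a, continuous (rep a);
  rep_linear : forall a, linear (rep a);
  rep_linear_alg : forall h, linear (rep ^~ h);
  rep_mul : forall a b h, rep (cmul a b) h = rep a (rep b h);
  rep_star : forall a h k, hip (rep a h) k = hip h (rep (cstar a) k)
}.

Definition linear_subspace (V : lmodType R[i]) (L : set V) : Prop :=
  L 0 /\ forall (l : R[i]) u v, L u -> L v -> L (l *: u + v).

(* Nonzero (which forces H to be nonzero) and topologically irreducible. *)
Definition irreducible H (sigma : representation H) : Prop :=
  (exists a h, sigma a h != 0) /\
  forall L : set H, closed L -> linear_subspace L ->
    (forall a h, L h -> L (sigma a h)) -> L = [set 0] \/ L = setT.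

Definition rep_ker H (sigma : representation H) : set D :=
  [set a | forall h, sigma a h = 0].

End Representations.
Arguments representation {R} D H.

(* Points of the spectrum are unitary equivalence classes of irreducible
   representations; they are handled through representatives, and every notion
   below depends on the class only. *)
Record spectrum (R : realType) (D : cstarAlgType R) := Spectrum {
  spec_space : hilbertType R;
  spec_rep :> representation D spec_space;
  spec_irr : irreducible spec_rep
}.

Section HullKernel.
Context {R : realType} {D : cstarAlgType R}.

(* spectrum D lies in too large a universe for set (spectrum D), so sets of
   points are written as plain predicates. *)
Definition hk_closure (S : spectrum D -> Prop) (sigma : spectrum D) : Prop :=
  forall a, (forall tau, S tau -> rep_ker tau a) -> rep_ker sigma a.

Definition hk_open (U : spectrum D -> Prop) : Prop :=
  forall sigma, hk_closure (fun tau => ~ U tau) sigma -> ~ U sigma.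

End HullKernel.

Definition directed_preorder (I : Type) (le : I -> I -> Prop) : Prop :=
  [/\ inhabited I, (forall i, le i i),
      (forall i j k, le i j -> le j k -> le i k) &
      forall i j, exists k, le i k /\ le j k].

Definition cluster_point (R : realType) (D : cstarAlgType R)
    (I : Type) (le : I -> I -> Prop) (net : I -> spectrum D)
    (pi : spectrum D) : Prop :=
  forall U, hk_open U -> U pi -> forall i, exists2 j, le i j & U (net j).

Definition net_limsup (R : realType) (I : Type) (le : I -> I -> Prop)
    (f : I -> \bar R) : \bar R :=
  ereal_inf [set ereal_sup [set f j | j in [set j | le i j]] | i in [set: I]].

Section UpperMultiplicity.
Context {R : realType} {D : cstarAlgType R}.

Definition topological_dual : set (D -> R[i]^o) :=
  [set f : D -> R[i]^o | scalar f /\ continuous f].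

(* The weak* topology on the dual is the one induced by pointwise convergence. *)
Definition weakstar_nbhd0 : set (set (D -> R[i]^o)) :=
  [set N | (exists2 O : set {ptws D -> R[i]^o}, open O & N = O `&` topological_dual)
           /\ N (fun=> 0)].

(* A linear functional of norm one which is nonnegative on the elements a^* a;
   the order of R[i] makes 0 <= z say that z is real and nonnegative. *)
Definition state (f : D -> R[i]) : Prop :=
  [/\ scalar f, (forall a, 0 <= f (cmul (cstar a) a)) &
      ereal_sup [set (complex.Re `|f a|)%:E | a in [set a | `|a| <= 1]]
        = 1%:E :> \bar R].

Definition pure_state (f : D -> R[i]) : Prop :=
  state f /\
  forall (g1 g2 : D -> R[i]) (t : R[i]), state g1 -> state g2 -> 0 < t < 1 ->
    (forall a, f a = t * g1 a + (1 - t) * g2 a) -> g1 = f /\ g2 = f.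

Definition vector_functional (sigma : spectrum D) (h : spec_space sigma)
    (a : D) : R[i] := hip (sigma a h) h.

Definition associated (sigma : spectrum D) (phi : D -> R[i]) : Prop :=
  exists2 h : spec_space sigma, `|h| = 1 & phi = vector_functional h.

Definition Vec (sigma : spectrum D) (phi : D -> R[i]) (N : set (D -> R[i]^o)) :
    set (spec_space sigma) :=
  [set h | `|h| = 1 /\ N (fun a => vector_functional h a - phi a)].

Definition orthonormal (H : hilbertType R) (n : nat) (e : 'I_n -> H) : Prop :=
  forall i j, hip (e i) (e j) = (i == j)%:R.

Definition vec_dim (sigma : spectrum D) (phi : D -> R[i])
    (N : set (D -> R[i]^o)) : \bar R :=
  ereal_sup [set n%:R%:E | n in [set n | exists e : 'I_n -> spec_space sigma,
    orthonormal e /\ forall i, Vec phi N (e i)]].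

(* M_U(pi, net), computed from a pure state phi associated with pi; pi enters
   the formula only through phi, and the value does not depend on phi. *)
Definition upper_mult (I : Type) (le : I -> I -> Prop) (phi : D -> R[i])
    (net : I -> spectrum D) : \bar R :=
  ereal_inf [set net_limsup le (fun i => vec_dim (net i) phi N)
            | N in weakstar_nbhd0].

End UpperMultiplicity.

Section HilbertModules.
Context {R : realType}.

Definition cpositive (D : cstarAlgType R) (b : D) : Prop :=
  exists c, b = cmul (cstar c) c.

Definition complete_for (X : lmodType R[i]) (nrm : X -> R[i]) : Prop :=
  forall u : nat -> X,
    (forall e, 0 < e -> exists N, forall m n, (N <= m)%N -> (N <= n)%N ->
      nrm (u m - u n) < e) ->
    exists x, forall e, 0 < e -> exists N, forall n, (N <= n)%N ->
      nrm (u n - x) < e.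

Definition lin_span (V : lmodType R[i]) (S : set V) : set V :=
  [set v | exists n (c : 'I_n -> R[i]) (s : 'I_n -> V),
     (forall i, S (s i)) /\ v = \sum_(i < n) c i *: s i].

Record rightHilbertModule (B : cstarAlgType R) (X : lmodType R[i]) :=
RightHilbertModule {
  ract : X -> B -> X;
  rip : X -> X -> B;
  ract_linearl : forall b, linear (ract ^~ b);
  ract_linearr : forall x, linear (ract x);
  ract_mul : forall x b c, ract x (cmul b c) = ract (ract x b) c;
  rip_linearr : forall x, linear (rip x);
  rip_ract : forall x y b, rip x (ract y b) = cmul (rip x y) b;
  rip_star : forall x y, cstar (rip x y) = rip y x;
  rip_positive : forall x, cpositive (rip x x);
  rip_definite : forall x, rip x x = 0 -> x = 0;
  rip_complete : complete_for (fun x => sqrtC `|rip x x|)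
}.

Record leftHilbertModule (A : cstarAlgType R) (X : lmodType R[i]) :=
LeftHilbertModule {
  lact : A -> X -> X;
  lip : X -> X -> A;
  lact_linearl : forall x, linear (lact ^~ x);
  lact_linearr : forall a, linear (lact a);
  lact_mul : forall a b x, lact (cmul a b) x = lact a (lact b x);
  lip_linearl : forall y, linear (lip ^~ y);
  lip_lact : forall a x y, lip (lact a x) y = cmul a (lip x y);
  lip_star : forall x y, cstar (lip x y) = lip y x;
  lip_positive : forall x, cpositive (lip x x);
  lip_definite : forall x, lip x x = 0 -> x = 0;
  lip_complete : complete_for (fun x => sqrtC `|lip x x|)
}.

(* "Acting by adjointable operators" means, as usual, that the action of an
   element has the action of its adjoint as adjoint. *)
Record imprimitivityBimodule (A B : cstarAlgType R) := ImprimitivityBimodule {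
  ib_space :> lmodType R[i];
  ib_left : leftHilbertModule A ib_space;
  ib_right : rightHilbertModule B ib_space;
  ib_assoc : forall a x b,
    ract ib_right (lact ib_left a x) b = lact ib_left a (ract ib_right x b);
  ib_left_full : dense (lin_span [set lip ib_left x y | x in setT & y in setT]);
  ib_right_full : dense (lin_span [set rip ib_right x y | x in setT & y in setT]);
  ib_left_adjoint : forall a x y,
    rip ib_right (lact ib_left a x) y = rip ib_right x (lact ib_left (cstar a) y);
  ib_right_adjoint : forall x b y,
    lip ib_left (ract ib_right x b) y = lip ib_left x (ract ib_right y (cstar b));
  ib_compat : forall x y z,
    lact ib_left (lip ib_left x y) z = ract ib_right x (rip ib_right y z)
}.

End HilbertModules.

(* rho is X-Ind pi: its space is the Hilbert space completion of the balanced
   tensor product, with t x h in the role of the elementary tensor of x and h.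
   These conditions determine (rho, t) up to a unique unitary equivalence. *)
Definition is_induced (R : realType) (A B : cstarAlgType R)
    (X : imprimitivityBimodule A B) (H K : hilbertType R)
    (pi : representation B H) (rho : representation A K) : Prop :=
  exists t : X -> H -> K,
    [/\ (forall h, linear (t ^~ h)) /\ (forall x, linear (t x)),
        (forall x b h, t (ract (ib_right X) x b) h = t x (pi b h)),
        (forall x y h k, hip (t x h) (t y k) = hip (pi (rip (ib_right X) y x) h) k),
        dense (lin_span [set t x h | x in setT & h in setT]) &
        forall a x h, rho a (t x h) = t (lact (ib_left X) a x) h].

(* Main.v *)
(* Let pi act on H and Ind pi on K, and fix unit vectors h0 in H and k0 in K
   defining phi and psi. By irreducibility there is x in X with x (x) h0 close
   to k0. For every sigma the map T : h |-> x (x) h satisfies T^* T = sigma(<x, x>)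
   and T^* (Ind sigma)(a) T = sigma(<x, a x>), so it carries vectors whose state is
   close to phi to vectors whose state is close to psi. It also almost preserves
   orthogonality: since phi is pure, any c in B is, up to a multiple of an element
   almost fixing h0, a sum l + m with l h0 and m^* h0 small, and these smallness
   conditions pass to all vectors whose state is close to phi; hence (c e | f) is
   small for orthogonal e, f of this kind. Gram-Schmidt then turns orthonormal
   families for phi into orthonormal families of the same size for psi. The
   converse inequality uses the adjoint maps K -> H and the inner product with
   values in A in the same way. *)
Require Import Defs.
From mathcomp Require Import all_boot all_order all_algebra.
From mathcomp Require Import all_classical all_reals all_analysis.
From mathcomp Require Import complex.
From mathcomp Require Import ring lra.

Set Implicit Arguments.
Unset Strict Implicit.
Unset Printing Implicit Defensive.

Import Order.TTheory GRing.Theory Num.Theory.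
Import numFieldNormedType.Exports.

Local Open Scope classical_set_scope.
Local Open Scope ring_scope.

(** * Real-valued norms *)

(** The obstacle is uniformity: of the vectors taken from the members of the net only finitely many
    values of their states are controlled. The splitting of c must therefore be made inside the
    algebra, at h0, before any index is chosen; the resulting weak* neighbourhood then serves the
    whole net. The element m must send h0 close to a prescribed vector while m^* almost kills h0, a
    two-sided form of Kadison transitivity. It is extracted from purity: minimising a quadratic form
    on the algebra leaves a residual vector, purity forces this residual to be a multiple of h0, and
    orthogonality to h0 forces the multiple to be zero. The converse inequality does not pass
    through the dual bimodule: the adjoints T^* satisfy compression identities of the same shape as
    T. *)

Definition cabs (R : realType) (z : R[i]) : R := complex.Re `|z|.

(** Norms take values in [R[i]], which is only partially ordered; real-valued versions allow
    suprema, infima and real arithmetic. *)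
Definition vnorm (R : realType) (V : normedModType R[i]) (v : V) : R :=
  complex.Re `|v|.

Section ComplexNumbers.
Context {R : realType}.
Implicit Types z w : R[i].

Lemma ge0_ReE z : 0 <= z -> z = (complex.Re z)%:C%C.
Proof. by move=> z0; rewrite RRe_real// ger0_real. Qed.

Lemma cabsE z : `|z| = (cabs z)%:C%C.
Proof. exact/ge0_ReE/normr_ge0. Qed.

Lemma cabs_ge0 z : 0 <= cabs z.
Proof. by rewrite -ler0c -cabsE. Qed.

Lemma cabsD z w : cabs (z + w) <= cabs z + cabs w.
Proof. by rewrite -lecR rmorphD -!cabsE ler_normD. Qed.

Lemma cabsM z w : cabs (z * w) = cabs z * cabs w.
Proof. by apply: complexI; rewrite rmorphM -!cabsE normrM. Qed.

Lemma cabsN z : cabs (- z) = cabs z.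
Proof. by rewrite /cabs normrN. Qed.

Lemma cabsB z w : cabs (z - w) <= cabs z + cabs w.
Proof. by rewrite -(cabsN w) cabsD. Qed.

Lemma cabsC z w : cabs (z - w) = cabs (w - z).
Proof. by rewrite -cabsN opprB. Qed.

Lemma cabs_conj z : cabs z^* = cabs z.
Proof. by rewrite /cabs norm_conjC. Qed.

Lemma cabs_real (x : R) : cabs x%:C%C = `|x|.
Proof. by rewrite /cabs normc_def /= expr0n /= addr0 sqrtr_sqr. Qed.

Lemma cabs0 : cabs (0 : R[i]) = 0.
Proof. by rewrite /cabs normr0. Qed.

Lemma cabs1 : cabs (1 : R[i]) = 1.
Proof. by rewrite /cabs normr1. Qed.

Lemma cabs_eq0 z : cabs z = 0 -> z = 0.
Proof. by move=> z0; apply/normr0_eq0; rewrite cabsE z0. Qed.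

Lemma conj_ReC (x : R) : (x%:C%C)^* = x%:C%C :> R[i].
Proof. exact: conjc_real. Qed.

Lemma mul_conj z : z * z^* = (cabs z ^+ 2)%:C%C.
Proof. by rewrite -normCK cabsE rmorphXn. Qed.

Lemma normRe_le z : `|complex.Re z| <= cabs z.
Proof. by rewrite -lecR -cabsE normc_ge_Re. Qed.

Lemma Re_le z : complex.Re z <= cabs z.
Proof. exact: le_trans (ler_norm _) (normRe_le z). Qed.

Lemma ReD z w : complex.Re (z + w) = complex.Re z + complex.Re w.
Proof. by case: z w => [a b] [c d]. Qed.

Lemma ReN z : complex.Re (- z) = - complex.Re z.
Proof. by case: z. Qed.

Lemma Re_conj z : complex.Re z^* = complex.Re z.
Proof. by case: z. Qed.

Lemma ReMr (x : R) z : complex.Re (x%:C%C * z) = x * complex.Re z.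
Proof. by case: z => a b /=; rewrite mul0r subr0. Qed.

Lemma ReR (x : R) : complex.Re (x%:C%C) = x.
Proof. by []. Qed.

Lemma conjM z w : (z * w)^* = z^* * w^*.
Proof. exact: rmorphM. Qed.

Lemma conjD z w : (z + w)^* = z^* + w^*.
Proof. exact: rmorphD. Qed.

Lemma conjN z : (- z)^* = - z^*.
Proof. exact: rmorphN. Qed.

End ComplexNumbers.

Section NormedModules.
Context {R : realType} {V : normedModType R[i]}.
Implicit Types u v w : V.

Lemma vnormE v : `|v| = (vnorm v)%:C%C.
Proof. exact/ge0_ReE/normr_ge0. Qed.

Lemma vnorm_ge0 v : 0 <= vnorm v.
Proof. by rewrite -ler0c -vnormE. Qed.

Lemma vnormD u v : vnorm (u + v) <= vnorm u + vnorm v.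
Proof. by have := ler_normD u v; rewrite !vnormE -rmorphD lecR. Qed.

Lemma vnormZ z v : vnorm (z *: v) = cabs z * vnorm v.
Proof. by have := normrZ z v; rewrite !vnormE cabsE -rmorphM => /complexI. Qed.

Lemma vnormN v : vnorm (- v) = vnorm v.
Proof. by rewrite /vnorm normrN. Qed.

Lemma vnormC u v : vnorm (u - v) = vnorm (v - u).
Proof. by rewrite -vnormN opprB. Qed.

Lemma vnorm0 : vnorm (0 : V) = 0.
Proof. by rewrite /vnorm normr0. Qed.

Lemma vnorm_eq0 v : vnorm v = 0 -> v = 0.
Proof. by move=> v0; apply/normr0_eq0; rewrite vnormE v0. Qed.

Lemma vnorm_dist u v w : vnorm (u - w) <= vnorm (u - v) + vnorm (v - w).
Proof. by rewrite -[u - w](subrKA v) vnormD. Qed.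

Lemma lt_vnorm v (e : R) : (`|v| < e%:C%C) = (vnorm v < e).
Proof. by rewrite vnormE ltcR. Qed.

Lemma gt0_complex (e : R[i]) : 0 < e -> exists2 x : R, 0 < x & e = x%:C%C.
Proof.
move=> e0; exists (complex.Re e); last exact/ge0_ReE/ltW.
by rewrite -ltcR -ge0_ReE// ltW.
Qed.

Lemma nbhs_vnormP v (A : set V) :
  nbhs v A <-> exists2 e : R, 0 < e & forall u, vnorm (u - v) < e -> A u.
Proof.
split=> [/nbhs_ballP[e /= e0 vA]|[e e0 vA]].
  have [x x0 xe] := gt0_complex e0; exists x => // u uv; apply: vA.
  by rewrite -ball_normE /= xe lt_vnorm vnormC.
apply/nbhs_ballP; exists e%:C%C; first by rewrite /= ltcR.
by move=> u; rewrite -ball_normE /= lt_vnorm vnormC; apply: vA.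
Qed.

Lemma closure_vnormP (A : set V) v :
  closure A v <-> forall e : R, 0 < e -> exists2 u, A u & vnorm (u - v) < e.
Proof.
split=> [Av e e0|Av B /nbhs_vnormP[e e0 vB]].
  have /Av[u [Au uv]] : nbhs v [set u | vnorm (u - v) < e].
    by apply/nbhs_vnormP; exists e.
  by exists u.
by have [u Au uv] := Av e e0; exists u; split => //; apply: vB.
Qed.

Definition approximable (A : set V) :=
  forall v (e : R), 0 < e -> exists2 u, A u & vnorm (u - v) < e.

Lemma dense_approximable (A : set V) : dense A -> approximable A.
Proof.
move=> Ad v e e0.
have [] := Ad (ball v e%:C%C).
- by exists v; apply: ballxx; rewrite ltcR.
- by apply: ball_open; rewrite ltcR.
- by move=> u [+ Au]; rewrite -ball_normE /= lt_vnorm vnormC; exists u.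
Qed.

Definition converges (u : nat -> V) (l : V) :=
  forall e : R, 0 < e -> exists N, forall n, (N <= n)%N -> vnorm (u n - l) < e.

End NormedModules.

Lemma continuousP_vnorm (R : realType) (V W : normedModType R[i]) (f : V -> W) :
  continuous f <-> forall v (e : R), 0 < e -> exists2 d : R, 0 < d &
    forall u, vnorm (u - v) < d -> vnorm (f u - f v) < e.
Proof.
split=> [fc v e e0|fc v A /nbhs_vnormP[e e0 fA]].
  have /(fc v)/nbhs_vnormP[d d0 dA] : nbhs (f v) [set w | vnorm (w - f v) < e].
    by apply/nbhs_vnormP; exists e.
  by exists d.
have [d d0 dA] := fc v e e0.
by apply/nbhs_vnormP; exists d => // u /dA; apply: fA.
Qed.

Lemma complete_vnorm (R : realType) (V : completeNormedModType R[i])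
    (u : nat -> V) :
  (forall e : R, 0 < e -> exists N, forall m n, (N <= m)%N -> (N <= n)%N ->
     vnorm (u m - u n) < e) -> exists l, converges u l.
Proof.
move=> uC.
have /cauchy_cvgP/cvg_ex[l /= ul] : cauchy (u @ \oo).
  apply/cauchy_ballP => e e0; have [x x0 xe] := gt0_complex e0.
  have [N uN] := uC x x0.
  exists (u @` [set n | (N <= n)%N], u @` [set n | (N <= n)%N]) => /=.
    by split; exists N => // n /= Nn; exists n.
  move=> [_ _] /= [[m Nm <-] [n Nn <-]].
  by rewrite -ball_normE /= xe lt_vnorm; apply: uN.
exists l => e e0.
have [|N _ uN] := ul [set w | vnorm (w - l) < e].
  by apply/nbhs_vnormP; exists e.
by exists N => n /uN.
Qed.

Lemma archimedean_inv (R : realType) (e : R) : 0 < e ->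
  exists N, forall n, (N <= n)%N -> n.+1%:R^-1 < e.
Proof.
move=> e0.
exists (Num.trunc e^-1) => n en.
rewrite -[e]invrK ltf_pV2 ?posrE ?invr_gt0 ?ltr0n//.
apply: lt_le_trans (Num.Theory.truncnS_gt _) _.
by rewrite ler_nat.
Qed.

(** * Hilbert spaces *)

Section HilbertSpaces.
Context {R : realType} {H : hilbertType R}.
Implicit Types (h k u v : H) (z : R[i]).

Lemma hipDl h k u : hip (h + k) u = hip h u + hip k u.
Proof. by have := hip_scalar u 1 h k; rewrite scale1r mul1r. Qed.

Lemma hip0l u : hip (0 : H) u = 0.
Proof. by apply: (addrI (hip 0 u)); rewrite -hipDl !addr0. Qed.

Lemma hipZl z h u : hip (z *: h) u = z * hip h u.
Proof. by have := hip_scalar u z h 0; rewrite hip0l !addr0. Qed.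

Lemma hipNl h u : hip (- h) u = - hip h u.
Proof. by rewrite -scaleN1r hipZl mulN1r. Qed.

Lemma hipBl h k u : hip (h - k) u = hip h u - hip k u.
Proof. by rewrite hipDl hipNl. Qed.

Lemma hipDr u h k : hip u (h + k) = hip u h + hip u k.
Proof. by rewrite hip_conj hipDl conjD -!hip_conj. Qed.

Lemma hipZr z u h : hip u (z *: h) = z^* * hip u h.
Proof. by rewrite hip_conj hipZl conjM -hip_conj. Qed.

Lemma hip0r u : hip u (0 : H) = 0.
Proof. by rewrite hip_conj hip0l rmorph0. Qed.

Lemma hipNr u h : hip u (- h) = - hip u h.
Proof. by rewrite hip_conj hipNl conjN -hip_conj. Qed.

Lemma hipBr u h k : hip u (h - k) = hip u h - hip u k.
Proof. by rewrite hipDr hipNr. Qed.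

Lemma hip_suml n (c : 'I_n -> H) u :
  hip (\sum_(i < n) c i) u = \sum_(i < n) hip (c i) u.
Proof. by elim/big_rec2: _ => [|i x y _ <-]; rewrite ?hip0l ?hipDl. Qed.

Lemma hip_vnorm h : hip h h = (vnorm h ^+ 2)%:C%C.
Proof. by rewrite hip_norm vnormE -rmorphXn. Qed.

Lemma Re_hip h : complex.Re (hip h h) = vnorm h ^+ 2.
Proof. by rewrite hip_vnorm. Qed.

Lemma vnorm_sqD h k :
  vnorm (h + k) ^+ 2 = vnorm h ^+ 2 + vnorm k ^+ 2 + 2 * complex.Re (hip h k).
Proof.
rewrite -!Re_hip hipDl !hipDr !ReD (hip_conj k h) Re_conj; ring.
Qed.

Lemma vnorm_sqB h k :
  vnorm (h - k) ^+ 2 = vnorm h ^+ 2 + vnorm k ^+ 2 - 2 * complex.Re (hip h k).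
Proof. by rewrite vnorm_sqD vnormN hipNr ReN mulrN. Qed.

Lemma cauchy_schwarz h k : cabs (hip h k) <= vnorm h * vnorm k.
Proof.
have [k0|kN0] := eqVneq (vnorm k) 0.
  by rewrite (vnorm_eq0 k0) hip0r cabs0 mulr_ge0 ?vnorm_ge0.
have k0 : 0 < vnorm k by rewrite lt_neqAle eq_sym kN0 vnorm_ge0.
have := vnorm_ge0 h; have := vnorm_ge0 k => kg hg.
rewrite -[leLHS]ger0_norm ?cabs_ge0// -[leRHS]ger0_norm ?mulr_ge0//.
rewrite -ler_sqr ?nnegrE// !real_normK ?num_real//.
have := sqr_ge0 (vnorm (((vnorm k) ^+ 2)%:C%C *: h - hip h k *: k)).
rewrite vnorm_sqB !vnormZ cabs_real normrX (ger0_norm kg) hipZl hipZr mulrA.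
rewrite [X in complex.Re X](_ : _ =
    (vnorm k ^+ 2)%:C%C * (hip h k * (hip h k)^*)); last by ring.
rewrite mul_conj ReMr ReR => sq.
have k2 : 0 < vnorm k ^+ 2 by rewrite exprn_gt0.
by rewrite -(ler_pM2l k2) -subr_ge0; move: sq; congr (0 <= _); ring.
Qed.

Lemma hip_bound h k u v :
  cabs (hip h k - hip u v) <= vnorm (h - u) * vnorm k + vnorm u * vnorm (k - v).
Proof.
rewrite [X in cabs X](_ : _ = hip (h - u) k + hip u (k - v)); last first.
  by rewrite hipBl hipBr; ring.
by rewrite (le_trans (cabsD _ _))// lerD ?cauchy_schwarz.
Qed.

Lemma hip_eq0 h : hip h h = 0 -> h = 0.
Proof.
rewrite hip_vnorm => /complexI/eqP; rewrite expf_eq0 /= => /eqP.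
exact: vnorm_eq0.
Qed.

Lemma dense_orthogonal (A : set H) h :
  approximable A -> (forall v, A v -> hip h v = 0) -> h = 0.
Proof.
move=> Ad hA; apply: vnorm_eq0; apply/eqP; apply: contraT => hN0.
have h0 : 0 < vnorm h by rewrite lt_neqAle eq_sym hN0 vnorm_ge0.
have [v Av vh] := Ad h (vnorm h) h0.
have := cauchy_schwarz h (v - h).
rewrite hipBr hA// sub0r cabsN hip_vnorm cabs_real ger0_norm ?sqr_ge0//.
rewrite expr2 ler_pM2l// => /le_lt_trans/(_ vh); rewrite ltxx //.
Qed.

Lemma lin_span_orthogonal (A : set H) h :
  (forall v, A v -> hip h v = 0) -> forall v, lin_span A v -> hip h v = 0.
Proof.
move=> hA _ [n [c [s [As ->]]]]; rewrite hip_conj hip_suml big1 ?rmorph0// => i _.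
by rewrite hipZl hip_conj hA// rmorph0 mulr0.
Qed.

End HilbertSpaces.

(** * Limits of inner products and a Riesz representation theorem *)

Section Limits.
Context {R : realType}.

Lemma cabs_eps0 (z : R[i]) : (forall e : R, 0 < e -> cabs z < e) -> z = 0.
Proof.
move=> ze; apply: cabs_eq0; apply/eqP; rewrite eq_le cabs_ge0 andbT.
by apply/ler_addgt0Pl => e e0; rewrite addr0 ltW// ze.
Qed.

Lemma hip_limit (H : hilbertType R) (u v : nat -> H) (l m : H) :
  converges u l -> converges v m -> forall e : R, 0 < e ->
  exists N, forall n, (N <= n)%N -> cabs (hip (u n) (v n) - hip l m) < e.
Proof.
move=> ul vm e e0.
have l0 := vnorm_ge0 l; have m0 := vnorm_ge0 m.
pose C := vnorm l + vnorm m + 2.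
pose d := Num.min 1 (e / (2 * C)).
have C0 : 0 < 2 * C by rewrite /C; lra.
have d0 : 0 < d by rewrite lt_min ltr01 divr_gt0.
have [N1 N1P] := ul d d0; have [N2 N2P] := vm d d0.
exists (maxn N1 N2) => n; rewrite geq_max => /andP[/N1P un /N2P vn].
apply: le_lt_trans (hip_bound _ _ _ _) _.
have d1 : d <= 1 by rewrite ge_min lexx.
have dC : d * (2 * C) <= e by rewrite -ler_pdivlMr// ge_min lexx orbT.
have vb : vnorm (v n) <= vnorm m + 1.
  have := vnormD (v n - m) m; rewrite subrK; lra.
have un0 := vnorm_ge0 (u n - l); have vn0 := vnorm_ge0 (v n).
have vmn0 := vnorm_ge0 (v n - m).
have h1 : vnorm (u n - l) * vnorm (v n) <= d * (vnorm m + 1).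
  by apply: ler_pM => //; lra.
have h2 : vnorm l * vnorm (v n - m) <= vnorm l * d.
  by apply: ler_wpM2l => //; lra.
move: dC; rewrite /C; nra.
Qed.

Lemma hip_limit_eq2 (H : hilbertType R) (u v u' v' : nat -> H) (l m l' m' : H) :
  converges u l -> converges v m -> converges u' l' -> converges v' m' ->
  (forall n, hip (u n) (v n) = hip (u' n) (v' n)) ->
  hip l m = hip l' m'.
Proof.
move=> ul vm ul' vm' uv; apply/eqP; rewrite -subr_eq0; apply/eqP/cabs_eps0 => e e0.
have e2 : 0 < e / 2 by lra.
have [N NP] := hip_limit ul vm e2; have [M MP] := hip_limit ul' vm' e2.
have {}NP := NP _ (leq_maxl N M); have {}MP := MP _ (leq_maxr N M).
rewrite [X in cabs X](_ : _ = (hip l m - hip (u (maxn N M)) (v (maxn N M))) +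
  (hip (u' (maxn N M)) (v' (maxn N M)) - hip l' m')); last by rewrite uv; ring.
by apply: le_lt_trans (cabsD _ _) _; rewrite cabsC; lra.
Qed.

Lemma converges_cst (V : normedModType R[i]) (l : V) : converges (fun=> l) l.
Proof. by move=> e e0; exists 0%N => n _; rewrite subrr vnorm0. Qed.

Lemma converges_inv (V : normedModType R[i]) (u : nat -> V) (l : V) :
  (forall n, vnorm (u n - l) < n.+1%:R^-1) -> converges u l.
Proof.
move=> ul e e0; have [N NP] := archimedean_inv e0.
by exists N => n /NP; apply: lt_trans (ul n).
Qed.

Lemma converges_cauchy (V : normedModType R[i]) (u : nat -> V) (l : V) :
  converges u l -> forall e : R, 0 < e -> exists N, forall m n,
    (N <= m)%N -> (N <= n)%N -> vnorm (u m - u n) < e.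
Proof.
move=> ul e e0; have [|N NP] := ul (e / 2); first by lra.
exists N => m n /NP um /NP un.
apply: le_lt_trans (vnorm_dist _ l _) _; rewrite (vnormC l); lra.
Qed.

(* Riesz representation in the completion of V for the form
   <f x, f y> + <g y, g x>, obtained by minimising |f x|^2 + |g x|^2 - 2 Re F x. *)
Lemma riesz (V : lmodType R[i]) (H : hilbertType R) (f g : V -> H)
    (F : V -> R[i]) (C : R) :
  (forall z x y, f (z *: x + y) = z *: f x + f y) ->
  (forall z x y, g (z *: x + y) = z^* *: g x + g y) ->
  (forall z x y, F (z *: x + y) = z * F x + F y) ->
  0 <= C ->
  (forall x, cabs (F x) ^+ 2 <= C * (vnorm (f x) ^+ 2 + vnorm (g x) ^+ 2)) ->
  exists (m : nat -> V) (u1 u2 : H),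
    [/\ converges (f \o m) u1, converges (g \o m) u2 &
        forall x, F x = hip (f x) u1 + hip u2 (g x)].
Proof.
move=> fl gl Fl C0 FC.
pose Q x := vnorm (f x) ^+ 2 + vnorm (g x) ^+ 2.
pose J x := Q x - 2 * complex.Re (F x).
pose b x y := hip (f x) (f y) + hip (g y) (g x).
have Q0 x : 0 <= Q x by rewrite addr_ge0 ?sqr_ge0.
(* From |F|^2 <= C Q the arithmetic-geometric mean inequality gives 2 |F| <= Q + C. *)
have Jlb x : - C <= J x.
  have FQ : 2 * cabs (F x) <= Q x + C.
    have := FC x; rewrite -/(Q x); have := Q0 x; have := cabs_ge0 (F x).
    move: (Q x) (cabs (F x)) => q c c0 q0 cq.
    rewrite -ler_sqr ?nnegrE ?mulr_ge0 ?addr_ge0//.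
    have := sqr_ge0 (q - C); nra.
  have := Re_le (F x); rewrite /J; lra.
have QB x t y : Q (t *: x + y) = cabs t ^+ 2 * Q x + Q y
                                  + 2 * complex.Re (t * b x y).
  rewrite /Q fl gl !vnorm_sqD !vnormZ cabs_conj !hipZl (mulrDr t) ReD.
  have -> : complex.Re (t^* * hip (g x) (g y)) = complex.Re (t * hip (g y) (g x)).
    by rewrite (hip_conj (g y)) -[in RHS]Re_conj conjM conjCK.
  ring.
have F0 : F 0 = 0.
  by have := Fl (-1) 0 0; rewrite scaler0 addr0 mulN1r addNr.
have QZ x t : Q (t *: x) = cabs t ^+ 2 * Q x.
  have f0 : f 0 = 0 by have := fl (-1) 0 0; rewrite scaler0 addr0 scaleN1r addNr.
  have g0 : g 0 = 0.
    by have := gl (-1) 0 0; rewrite scaler0 addr0 rmorphN1 scaleN1r addNr.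
  have Q00 : Q 0 = 0 by rewrite /Q f0 g0 !vnorm0 expr0n addr0.
  have := QB x t 0; rewrite addr0 /b f0 g0 hip0r hip0l addr0 mulr0 Q00 => ->.
  by rewrite /= mulr0 !addr0.
have [hs lb] : has_inf (range J).
  by split; [exists (J 0), 0|exists (- C) => _ [x _ <-]].
pose d := inf (range J).
have dJ x : d <= J x by apply: ge_inf => //; exists x.
have mP n : exists x, J x < d + n.+1%:R^-1.
  have [|_ [x _ <-] Jx] := @inf_adherent _ (range J) n.+1%:R^-1 _ (conj hs lb).
    by rewrite invr_gt0 ltr0n.
  by exists x.
pose m n := sval (cid (mP n)).
have Jm n : J (m n) < d + n.+1%:R^-1 := svalP (cid (mP n)).
(* Parallelogram law: at the midpoint of [m i] and [m j], J is the mean of its two values minus Q(m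
   i - m j) / 4, and it is still at least d. *)
have cauchyQ (e : R) : 0 < e -> exists N, forall i j, (N <= i)%N -> (N <= j)%N ->
    Q (m i - m j) < e.
  move=> e0; have [|N NP] := @archimedean_inv R (e / 4); first by lra.
  exists N => i j /NP iN /NP jN.
  have := dJ (2^-1%:C%C *: (m i + m j)).
  rewrite /J QZ cabs_real ger0_norm ?invr_ge0//.
  have -> : F (2^-1%:C%C *: (m i + m j)) = 2^-1%:C%C * (F (m i) + F (m j)).
    have := Fl (2^-1%:C%C) (m i + m j) 0; rewrite !addr0 F0 addr0 => ->.
    by have := Fl 1 (m i) (m j); rewrite scale1r mul1r => ->.
  rewrite ReMr ReD.
  have := QB (m i) 1 (m j); rewrite scale1r mul1r cabs1 expr1n mul1r => ->.
  have := QB (m j) (-1) (m i); rewrite scaleN1r cabsN cabs1 expr1n mul1r mulN1r.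
  rewrite [- _ + _]addrC ReN => ->.
  have -> : complex.Re (b (m j) (m i)) = complex.Re (b (m i) (m j)).
    rewrite /b -Re_conj conjD -!hip_conj //.
  have := Jm i; have := Jm j; rewrite /J; move: iN jN.
  move: (Q (m i)) (Q (m j)) (complex.Re (F (m i))) (complex.Re (F (m j))).
  move: (complex.Re (b (m i) (m j))) => c' r s q p; clearbody d.
  by move: (i.+1%:R^-1) (j.+1%:R^-1) => i' j'; lra.
have cauchy_of (k : V -> H) : (forall x y, k (x - y) = k x - k y) ->
    (forall x, vnorm (k x) ^+ 2 <= Q x) -> exists l, converges (k \o m) l.
  move=> kB kQ; apply: complete_vnorm => e e0.
  have [|N NP] := @cauchyQ (e ^+ 2); first by rewrite exprn_gt0.
  exists N => i j iN jN /=; rewrite -kB -(@ltr_pXn2r _ 2)// ?nnegrE ?vnorm_ge0 ?ltW//.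
  by apply: le_lt_trans (kQ _) (NP _ _ iN jN).
have [u1 u1P] : exists l, converges (f \o m) l.
  apply: cauchy_of => [x y|x]; last by rewrite /Q lerDl sqr_ge0.
  by have := fl (-1) y x; rewrite !scaleN1r addrC => ->; rewrite addrC.
have [u2 u2P] : exists l, converges (g \o m) l.
  apply: cauchy_of => [x y|x]; last by rewrite /Q lerDr sqr_ge0.
  by have := gl (-1) y x; rewrite rmorphN1 !scaleN1r addrC => ->; rewrite addrC.
exists m, u1, u2; split => // x.
(* The error w measures the gradient of J at [m n] in the direction x. Moving [m n] by -s conj(w) x
   with s = 1 / (Q x + 1) lowers J by at least s |w|^2, and near-minimality leaves room for less
   than 1 / (n + 1). *)
have wn n : cabs (b x (m n) - F x) ^+ 2 <= (Q x + 1) * n.+1%:R^-1.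
  have [w wE] : exists w, w = b x (m n) - F x by exists (b x (m n) - F x).
  have bw : b x (m n) = w + F x by rewrite wE subrK.
  rewrite -wE; pose s : R := (Q x + 1)^-1.
  have Q1 : 0 < Q x + 1 by have := Q0 x; lra.
  have s0 : 0 < s by rewrite invr_gt0.
  have sQ : s * (Q x + 1) = 1 by rewrite mulVf ?gt_eqF.
  have := dJ ((- (s%:C%C * w^*)) *: x + m n).
  rewrite /J QB Fl ReD cabsN cabsM cabs_real cabs_conj (ger0_norm (ltW s0)).
  rewrite bw (mulrDr _ w) ReD.
  rewrite (_ : - (s%:C%C * w^*) * w = - (s%:C%C * (w * w^*))); last by ring.
  rewrite mul_conj ReN ReMr ReR.
  have := Jm n; rewrite /J; set W := cabs w ^+ 2 => Jmn Jt.
  have W0 : 0 <= W by rewrite sqr_ge0.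
  have sW : s * W <= n.+1%:R^-1.
    have e1 : (s * cabs w) ^+ 2 * Q x = s * W * (s * (Q x + 1)) - s ^+ 2 * W.
      by rewrite /W; ring.
    move: Jt Jmn; rewrite e1 sQ; move: (n.+1%:R^-1) => n'.
    have : 0 <= s ^+ 2 * W by rewrite mulr_ge0 ?sqr_ge0.
    lra.
  rewrite mulrC -ler_pdivrMr// mulrC; exact: sW.
apply/eqP; rewrite -subr_eq0; apply/eqP/cabs_eps0 => e e0.
have Q1 : 0 < Q x + 1 by have := Q0 x; lra.
have e3 : 0 < e / 3 by lra.
have [N1 N1P] := hip_limit (converges_cst (f x)) u1P e3.
have [N2 N2P] := hip_limit u2P (converges_cst (g x)) e3.
have [|N3 N3P] := @archimedean_inv R ((e / 3) ^+ 2 / (Q x + 1)).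
  by rewrite divr_gt0 ?exprn_gt0.
pose n := maxn N1 (maxn N2 N3).
have {}N1P := N1P n (leq_maxl _ _).
have {}N2P : cabs (hip (g (m n)) (g x) - hip u2 (g x)) < e / 3.
  by apply: N2P; rewrite /n !leq_max leqnn orbT.
have {}N3P : cabs (b x (m n) - F x) < e / 3.
  rewrite -(@ltr_pXn2r _ 2)// ?nnegrE ?cabs_ge0 ?ltW//.
  apply: le_lt_trans (wn n) _; rewrite mulrC -ltr_pdivlMr//.
  by apply: N3P; rewrite /n !leq_max leqnn !orbT.
rewrite [X in cabs X](_ : _ = - (b x (m n) - F x) +
   ((hip (f x) (f (m n)) - hip (f x) u1) + (hip (g (m n)) (g x) - hip u2 (g x)))).
  apply: le_lt_trans (cabsD _ _) _; rewrite cabsN.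
  have := cabsD (hip (f x) (f (m n)) - hip (f x) u1)
    (hip (g (m n)) (g x) - hip u2 (g x)).
  move: N1P => /=; lra.
by rewrite /b; ring.
Qed.

End Limits.

(** * Contractivity of representations *)

Lemma expr_small (R : realType) (q e : R) : 0 <= q < 1 -> 0 < e ->
  exists N, forall n, (N <= n)%N -> q ^+ n < e.
Proof.
move=> /andP[q0 q1] e0.
have /cvgrPdist_lt/(_ _ e0)[N _ NP] : (GRing.exp q : R ^nat) @ \oo --> (0 : R).
  by apply: cvg_expr; rewrite ger0_norm.
exists N => n /NP /=.
by rewrite sub0r normrN ger0_norm// exprn_ge0.
Qed.

Lemma banach_fixpoint (R : realType) (V : completeNormedModType R[i])
    (f : V -> V) (q : R) : 0 <= q < 1 ->
  (forall x y, vnorm (f x - f y) <= q * vnorm (x - y)) -> exists p, p = f p.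
Proof.
move=> q01 fq; have /andP[q0 q1] := q01.
have q1' : 0 < 1 - q by rewrite subr_gt0.
have near m x : vnorm (iter m f x - x) <= vnorm (f x - x) / (1 - q).
  elim: m x => [|m IH] x; first by rewrite subrr vnorm0 divr_ge0 ?vnorm_ge0 ?ltW.
  rewrite iterSr; apply: le_trans (vnorm_dist _ (f x) _) _.
  have := IH (f x); have := fq (f x) x; rewrite !ler_pdivlMr//.
  have := vnorm_ge0 (f x - x); nra.
pose u n := iter n f 0; pose C := vnorm (f 0) / (1 - q).
have C0 : 0 <= C by rewrite divr_ge0 ?vnorm_ge0 ?ltW.
have step n : vnorm (u n.+1 - u n) <= q ^+ n * vnorm (f 0).
  elim: n => [|n IH]; first by rewrite /u /= subr0 expr0 mul1r.
  by apply: le_trans (fq _ _) _; rewrite exprS -mulrA ler_wpM2l.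
have tail n m : vnorm (u (m + n)%N - u n) <= q ^+ n * C.
  rewrite /u iterD; apply: le_trans (near _ _) _.
  by rewrite mulrA ler_pM2r ?invr_gt0//; apply: step.
have [e e0|l ul] := complete_vnorm (u := u).
  have [|N NP] := expr_small q01 (e := e / (2 * (C + 1))).
    by rewrite divr_gt0//; lra.
  exists N => m n Nm Nn; apply: le_lt_trans (vnorm_dist _ (u N) _) _.
  have := tail N (m - N)%N; have := tail N (n - N)%N; rewrite !subnK// (vnormC (u n)).
  have := NP N (leqnn N); rewrite ltr_pdivlMr; last by lra.
  have := exprn_ge0 N q0; move: (q ^+ N) => z; nra.
exists l; apply/eqP; rewrite -subr_eq0; apply/eqP/vnorm_eq0/eqP.
rewrite eq_le vnorm_ge0 andbT; apply/ler_addgt0Pl => e e0; rewrite addr0.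
have [|N NP] := ul (e / 2); first by lra.
have a := NP N (leqnn N); have b := NP N.+1 (leqnSn N).
apply: le_trans (vnorm_dist _ (u N.+1) _) _; rewrite (vnormC l).
have := fq (u N) l; rewrite -/(u N.+1); have := vnorm_ge0 (u N - l); nra.
Qed.

Section LinearMaps.
Context {R : realType} {V W : lmodType R[i]} (f : V -> W).
Hypothesis fl : linear f.

Lemma linear_map0 : f 0 = 0.
Proof. by have := fl (-1) 0 0; rewrite scaler0 addr0 scaleN1r addNr. Qed.

Lemma linear_mapZ z x : f (z *: x) = z *: f x.
Proof. by have := fl z x 0; rewrite linear_map0 !addr0. Qed.

Lemma linear_mapD x y : f (x + y) = f x + f y.
Proof. by have := fl 1 x y; rewrite !scale1r. Qed.

Lemma linear_mapN x : f (- x) = - f x.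
Proof. by rewrite -[- x]scaleN1r linear_mapZ scaleN1r. Qed.

Lemma linear_mapB x y : f (x - y) = f x - f y.
Proof. by rewrite linear_mapD linear_mapN. Qed.

Lemma linear_map_sum n (c : 'I_n -> V) :
  f (\sum_(i < n) c i) = \sum_(i < n) f (c i).
Proof.
by elim/big_rec2: _ => [|i x y _ <-]; rewrite ?linear_map0 ?linear_mapD.
Qed.

End LinearMaps.

Lemma linear_bound (R : realType) (V W : normedModType R[i]) (f : V -> W) :
  linear f -> continuous f ->
  exists2 M : R, 0 <= M & forall v, vnorm (f v) <= M * vnorm v.
Proof.
move=> fl /continuousP_vnorm/(_ 0 1 ltr01)[d d0 fd].
have M0 : 0 < 2 / d by rewrite divr_gt0.
exists (2 / d) => [|v]; first exact: ltW.
have [v0|vN0] := eqVneq (vnorm v) 0.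
  by rewrite (vnorm_eq0 v0) (linear_map0 fl) !vnorm0 mulr0.
have v0 : 0 < vnorm v by rewrite lt_neqAle eq_sym vN0 vnorm_ge0.
have K0 : 0 < 2 / d * vnorm v by rewrite mulr_gt0.
have c0 : 0 < (2 / d * vnorm v)^-1 by rewrite invr_gt0.
(* The scalar brings v to norm d / 2. *)
have cv : vnorm ((2 / d * vnorm v)^-1%:C%C *: v - 0) < d.
  rewrite subr0 vnormZ cabs_real gtr0_norm// mulrC ltr_pdivrMr//.
  have -> : d * (2 / d * vnorm v) = 2 * vnorm v by field; rewrite gt_eqF.
  lra.
have := fd _ cv.
rewrite (linear_map0 fl) (linear_mapZ fl) subr0 vnormZ cabs_real gtr0_norm//.
by rewrite mulrC ltr_pdivrMr// mul1r => /ltW.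
Qed.

Section Representations.
Context {R : realType} {D : cstarAlgType R} {H : hilbertType R}.
Variable sigma : representation D H.
Implicit Types (a b : D) (h k : H).

Lemma repD a h k : sigma a (h + k) = sigma a h + sigma a k.
Proof. exact: linear_mapD (rep_linear sigma a) _ _. Qed.
Lemma repB a h k : sigma a (h - k) = sigma a h - sigma a k.
Proof. exact: linear_mapB (rep_linear sigma a) _ _. Qed.
Lemma repZ a z h : sigma a (z *: h) = z *: sigma a h.
Proof. exact: linear_mapZ (rep_linear sigma a) _ _. Qed.
Lemma rep0 a : sigma a 0 = 0.
Proof. exact: linear_map0 (rep_linear sigma a). Qed.
Lemma repDa a b h : sigma (a + b) h = sigma a h + sigma b h.
Proof. exact: linear_mapD (rep_linear_alg sigma h) _ _. Qed.
Lemma repBa a b h : sigma (a - b) h = sigma a h - sigma b h.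
Proof. exact: linear_mapB (rep_linear_alg sigma h) _ _. Qed.
Lemma repZa a z h : sigma (z *: a) h = z *: sigma a h.
Proof. exact: linear_mapZ (rep_linear_alg sigma h) _ _. Qed.
Lemma rep0a h : sigma 0 h = 0.
Proof. exact: linear_map0 (rep_linear_alg sigma h). Qed.

Lemma rep_starr a h k : hip h (sigma a k) = hip (sigma (cstar a) h) k.
Proof. by rewrite rep_star (cstarK a). Qed.

Lemma vnorm_rep_sq a h :
  (vnorm (sigma a h) ^+ 2)%:C%C = hip (sigma (cmul (cstar a) a) h) h.
Proof. by rewrite -hip_vnorm rep_mul [in RHS]rep_star (cstarK a). Qed.

Lemma rep_bound a : exists2 M : R, 0 <= M &
  forall h, vnorm (sigma a h) <= M * vnorm h.
Proof. apply: linear_bound; [exact: rep_linear | exact: rep_continuous]. Qed.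

Lemma vnorm_cmul a b : vnorm (cmul a b) <= vnorm a * vnorm b.
Proof. by have := cmul_norm a b; rewrite !vnormE -rmorphM lecR. Qed.

Lemma vnorm_cstar a : vnorm (cmul (cstar a) a) = vnorm a ^+ 2.
Proof. by have := cstar_norm a; rewrite !vnormE -rmorphXn => /complexI. Qed.

(** The sum s = b + b^2 + ... replaces the inverse 1 + s of 1 - b, since the algebra need not have a
    unit. *)
Lemma neumann b : vnorm b < 1 -> exists s, s = b + cmul s b.
Proof.
move=> b1; apply: (@banach_fixpoint _ _ (fun s => b + cmul s b) (vnorm b)).
  by rewrite vnorm_ge0.
move=> x y; rewrite opprD addrACA subrr add0r.
by rewrite -(linear_mapB (cmul_linearl b)) mulrC vnorm_cmul.
Qed.

Lemma rep_adjoint_bound a (M : R) : 0 <= M ->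
  (forall h, vnorm (sigma a h) <= M * vnorm h) ->
  forall h, vnorm (sigma (cstar a) h) <= M * vnorm h.
Proof.
move=> M0 aM h; have := cauchy_schwarz (sigma a (sigma (cstar a) h)) h.
rewrite rep_star hip_vnorm cabs_real ger0_norm ?sqr_ge0// => le1.
have := aM (sigma (cstar a) h) => le2.
have [v0|vN0] := eqVneq (vnorm (sigma (cstar a) h)) 0.
  by rewrite v0 mulr_ge0 ?vnorm_ge0.
have v0 : 0 < vnorm (sigma (cstar a) h) by rewrite lt_neqAle eq_sym vN0 vnorm_ge0.
rewrite -(ler_pM2r v0) -expr2; apply: le_trans le1 _.
by apply: le_trans (ler_wpM2r (vnorm_ge0 h) le2) _; rewrite mulrAC.
Qed.

(* If the operator norm r of sigma a exceeded |a|, then 1 - r^-2 sigma (a^* a)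
   would be invertible by the Neumann series although it almost annihilates
   the unit vectors at which r is almost attained. *)
Lemma rep_contraction a h : vnorm (sigma a h) <= vnorm a * vnorm h.
Proof.
have [M M0 aM] := rep_bound a.
pose S := [set vnorm (sigma a k) | k in [set k | vnorm k <= 1]].
have S0 : S 0 by exists 0; rewrite /= ?vnorm0// rep0 vnorm0.
have Sub : has_ubound S.
  exists M => _ [k /= k1 <-]; apply: le_trans (aM k) _.
  by rewrite -[leRHS]mulr1 ler_wpM2l.
have Ssup : has_sup S by split => //; exists 0.
pose r := sup S.
have Sr x : S x -> x <= r by move=> Sx; apply: (sup_upper_bound Ssup).
have r0 : 0 <= r by apply: Sr.
have ar k : vnorm (sigma a k) <= r * vnorm k.
  have [k0|kN0] := eqVneq (vnorm k) 0.
    by rewrite (vnorm_eq0 k0) rep0 !vnorm0 mulr0.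
  have k0 : 0 < vnorm k by rewrite lt_neqAle eq_sym kN0 vnorm_ge0.
  have : vnorm (sigma a ((vnorm k)^-1%:C%C *: k)) <= r.
    apply: Sr; exists ((vnorm k)^-1%:C%C *: k) => //=.
    by rewrite vnormZ cabs_real gtr0_norm ?invr_gt0// mulVf.
  by rewrite repZ vnormZ cabs_real gtr0_norm ?invr_gt0// mulrC ler_pdivrMr.
have [ra|ra] := lerP r (vnorm a).
  by apply: le_trans (ar h) _; rewrite ler_wpM2r ?vnorm_ge0.
have a0 := vnorm_ge0 a; have {}r0 : 0 < r by lra.
pose b := (r ^- 2)%:C%C *: cmul (cstar a) a.
have r2 : 0 < r ^- 2 by rewrite invr_gt0 exprn_gt0.
have [|s sE] := @neumann b.
  rewrite vnormZ cabs_real gtr0_norm// vnorm_cstar mulrC.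
  by rewrite ltr_pdivrMr ?exprn_gt0// mul1r ltr_pXn2r// nnegrE// ltW.
have [L L0 sL] := rep_bound s.
(* This is (1 + s)(1 - b) = 1 applied to k, read off from s = b + s b. *)
have decomp k : k = (k - sigma b k) + sigma s (k - sigma b k).
  by rewrite repB -rep_mul {1}sE repDa addrK subrK.
have bk k : vnorm (sigma b k) <= vnorm k.
  rewrite repZa vnormZ cabs_real gtr0_norm// rep_mul.
  rewrite mulrC ler_pdivrMr ?exprn_gt0//.
  apply: le_trans (rep_adjoint_bound (ltW r0) ar _) _.
  by rewrite expr2 mulrA [leRHS]mulrC ler_pM2l// mulrC.
(* A k in the unit ball with |sigma a k| > r (1 - t) satisfies |k - b k|^2 <= 4 t, whereas |k| <= (1
   + L) |k - b k|. With this t the two give (1 - t)^2 <= 1 / 8, against t <= 1 / 2. *)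
pose t : R := (32 * (1 + L) ^+ 2)^-1.
have L1 : 0 < 32 * (1 + L) ^+ 2 by rewrite mulr_gt0// exprn_gt0//; lra.
have t0 : 0 < t by rewrite invr_gt0.
have tL : t * (32 * (1 + L) ^+ 2) = 1 by rewrite mulVf ?gt_eqF.
have t1 : t <= 1 / 2 by nra.
have [|_ [k /= k1 <-] rk] := @sup_adherent _ S (r * t) _ Ssup.
  by rewrite mulr_gt0.
have kt : 1 - t <= vnorm k.
  rewrite -(ler_pM2l r0); apply: le_trans (ar k); rewrite -/r in rk; lra.
have small : vnorm (k - sigma b k) ^+ 2 <= 4 * t.
  have bE : hip (sigma b k) k = (r ^- 2 * vnorm (sigma a k) ^+ 2)%:C%C.
    by rewrite repZa hipZl -vnorm_rep_sq -rmorphM.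
  rewrite vnorm_sqB hip_conj Re_conj bE ReR.
  have le1 : (1 - t) ^+ 2 <= r ^- 2 * vnorm (sigma a k) ^+ 2.
    rewrite mulrC ler_pdivlMr ?exprn_gt0// -exprMn ler_pXn2r ?nnegrE ?vnorm_ge0//.
      rewrite -/r in rk; lra.
    by rewrite mulr_ge0 ?ltW//; lra.
  have := bk k; have := vnorm_ge0 (sigma b k); have := vnorm_ge0 k.
  move: le1; move: (r ^- 2 * _) (vnorm (sigma b k)) => x y; move: (vnorm k) k1.
  by move=> z *; nra.
have := vnormD (k - sigma b k) (sigma s (k - sigma b k)); rewrite -decomp.
have := sL (k - sigma b k); have := vnorm_ge0 (k - sigma b k).
move: small; move: (vnorm (k - _)) => w small w0 le1 le2.
have : 1 - t <= (1 + L) * w by lra.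
rewrite -(@ler_pXn2r _ 2) ?nnegrE ?mulr_ge0//; try lra.
by rewrite exprMn; have := sqr_ge0 (1 + L); nra.
Qed.

End Representations.

(** * Irreducibility and purity *)

Section Irreducible.
Context {R : realType} {D : cstarAlgType R} {H : hilbertType R}.
Variable sigma : representation D H.
Hypothesis irr : irreducible sigma.

(** Irreducibility speaks of closed subspaces only; by continuity the closure of L is again an
    invariant subspace, and it is not zero. *)
Lemma invariant_approximable (L : set H) : linear_subspace L ->
  (forall a h, L h -> L (sigma a h)) -> (exists2 h, L h & h != 0) ->
  approximable L.
Proof.
move=> [L0 Ll] Linv [h Lh hN0].
have [|||clL|clL] := irr.2 (closure L).
- exact: closed_closure.
- split; first exact: subset_closure.
  move=> z u v /closure_vnormP Lu /closure_vnormP Lv; apply/closure_vnormP => e e0.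
  have c0 := cabs_ge0 z.
  have [|u' Lu' uu'] := Lu (e / (2 * (cabs z + 1))); first by rewrite divr_gt0//; lra.
  have [|v' Lv' vv'] := Lv (e / 2); first by lra.
  exists (z *: u' + v'); first exact: Ll.
  rewrite opprD addrACA -scalerBr; apply: le_lt_trans (vnormD _ _) _.
  rewrite vnormZ; move: uu'; rewrite ltr_pdivlMr; last by lra.
  have := vnorm_ge0 (u' - u); move: (vnorm (u' - u)) => x; nra.
- move=> a u /closure_vnormP Lu; apply/closure_vnormP => e e0.
  have [M M0 aM] := rep_bound sigma a.
  have [|u' Lu' uu'] := Lu (e / (M + 1)); first by rewrite divr_gt0//; lra.
  exists (sigma a u'); first exact: Linv.
  rewrite -repB; apply: le_lt_trans (aM _) _.
  move: uu'; rewrite ltr_pdivlMr; last by lra.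
  have := vnorm_ge0 (u' - u); nra.
- have : closure L h by apply: subset_closure.
  by rewrite clL => /= h0; rewrite h0 eqxx in hN0.
- move=> v e e0; have : closure L v by rewrite clL.
  by move/closure_vnormP; apply.
Qed.

(** The vectors killed by all of D form an invariant subspace. If it were nonzero it would be dense,
    and every [sigma a] would vanish by continuity, against the first clause of [irreducible]. *)
Lemma rep_nondegenerate h : h != 0 -> exists a, sigma a h != 0.
Proof.
move=> hN0; apply: contrapT => /forallNP ah.
have {}ah a : sigma a h = 0 by apply/eqP; apply: contra_notT (ah a).
have [a [k akN0]] := irr.1.
pose L := [set u | forall b, sigma b u = 0].
have Lapprox : approximable L.
  apply: invariant_approximable; last by exists h.
    by split=> [b|z x y xL yL b]; rewrite ?rep0// repD repZ xL yL scaler0 addr0.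
  by move=> b x xL c; rewrite xL rep0.
have [M M0 aM] := rep_bound sigma a.
have ak0 : 0 < vnorm (sigma a k).
  rewrite lt_neqAle vnorm_ge0 andbT eq_sym; apply: contraNneq akN0 => /vnorm_eq0.
  by move=> ->.
have [|v Lv vk] := Lapprox k (vnorm (sigma a k) / (M + 1)).
  by rewrite divr_gt0//; lra.
have := aM (v - k); rewrite repB Lv sub0r vnormN.
move: vk; rewrite ltr_pdivlMr; last by lra.
have := vnorm_ge0 (v - k); nra.
Qed.

Lemma cyclic_approximable h : h != 0 -> approximable (range (sigma ^~ h)).
Proof.
move=> hN0; apply: invariant_approximable.
- split; first by exists 0; rewrite ?rep0a.
  move=> z _ _ [a _ <-] [b _ <-]; exists (z *: a + b) => //.
  by rewrite repDa repZa.
- by move=> a _ [b _ <-]; exists (cmul a b); rewrite ?rep_mul.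
- by have [a ahN0] := rep_nondegenerate hN0; exists (sigma a h) => //; exists a.
Qed.

Lemma cyclic_sequence h k : h != 0 ->
  exists b : nat -> D, converges (fun n => sigma (b n) h) k.
Proof.
move=> hN0.
have bP n : exists b, vnorm (sigma b h - k) < n.+1%:R^-1.
  have [|_ [b _ <-] bk] := @cyclic_approximable h hN0 k n.+1%:R^-1.
    by rewrite invr_gt0 ltr0n.
  by exists b.
by exists (fun n => sval (cid (bP n))); apply: converges_inv => n; case: cid.
Qed.

Lemma cyclic_orthogonal h k : h != 0 -> (forall a, hip k (sigma a h) = 0) -> k = 0.
Proof.
move=> hN0 kh; apply: (dense_orthogonal (cyclic_approximable hN0)).
by move=> _ [a _ <-].
Qed.

End Irreducible.

Section Purity.
Context {R : realType} {D : cstarAlgType R} (sigma : spectrum D).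
Let H := spec_space sigma.
Implicit Types (h p q : H) (a : D).

Lemma vector_functional_scalar h : scalar (vector_functional h).
Proof. by move=> z a b; rewrite /vector_functional repDa repZa hipDl hipZl. Qed.

Lemma vector_functional_ge0 h a : 0 <= vector_functional h (cmul (cstar a) a).
Proof. by rewrite /vector_functional -vnorm_rep_sq ler0c sqr_ge0. Qed.

Lemma vector_functional_bound h a :
  cabs (vector_functional h a) <= vnorm a * vnorm h ^+ 2.
Proof.
apply: le_trans (cauchy_schwarz _ _) _; rewrite expr2 mulrA.
by rewrite ler_wpM2r ?vnorm_ge0// rep_contraction.
Qed.

(** Only the norm of g is at stake. Where |f a| is close to 1, so is t |g a| + (1 - t) |g' a|; both
    moduli being at most 1, |g a| is close to 1 too. *)
Lemma state_convex_component (f g g' : D -> R[i]) (t : R) : state f -> 0 < t < 1 ->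
  scalar g -> (forall a, 0 <= g (cmul (cstar a) a)) ->
  (forall a, vnorm a <= 1 -> cabs (g a) <= 1) ->
  (forall a, vnorm a <= 1 -> cabs (g' a) <= 1) ->
  (forall a, f a = t%:C%C * g a + (1 - t%:C%C) * g' a) -> state g.
Proof.
move=> [_ _ f1] /andP[t0 t1] gl g0 gb gb' fE; split => //.
have unit a : `|a| <= 1 -> vnorm a <= 1 by rewrite vnormE -[1]/(1%:C%C) lecR.
apply/eqP; rewrite eq_le; apply/andP; split.
  by apply: ge_ereal_sup => _ [a /= /unit a1 <-]; rewrite lee_fin gb.
apply/lee_addgt0Pr => e e0.
(* The tolerance t e becomes e after division by the weight t of g. *)
have [||_ [a /= a1 <-]] := @ub_ereal_sup_adherent _
    [set (complex.Re `|f a|)%:E | a in [set a | `|a| <= 1]] (t * e).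
- exact: mulr_gt0.
- by rewrite f1.
rewrite f1 -EFinB lte_fin => fa; have {}fa : 1 - t * e < cabs (f a) := fa.
have t1' : 0 < 1 - t by lra.
apply: (@le_trans _ _ ((cabs (g a))%:E + e%:E)%E).
  rewrite -EFinD lee_fin -(ler_pM2l t0).
  have := cabsD (t%:C%C * g a) ((1 - t%:C%C) * g' a); rewrite -fE !cabsM.
  have -> : 1 - t%:C%C = (1 - t)%:C%C by rewrite rmorphB rmorph1.
  rewrite !cabs_real (gtr0_norm t0) (gtr0_norm t1').
  move: fa (gb' a (unit a a1)).
  move: (cabs (f a)) (cabs (g a)) (cabs (g' a)) => x y z; nra.
by apply: leeD => //; apply: ereal_sup_ubound; exists a.
Qed.

(** Normalised, the functionals of p and q are states, and phi is their convex combination with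
    weights |p|^2 and |q|^2. A vanishing p or q is settled by t = 0 or t = 1. *)
Lemma pure_split (phi : D -> R[i]) p q : pure_state phi ->
  (forall a, phi a = vector_functional p a + vector_functional q a) ->
  vnorm p ^+ 2 + vnorm q ^+ 2 = 1 ->
  exists t : R, forall a, vector_functional p a = t%:C%C * phi a.
Proof.
move=> [phis phip] phiE pq.
have [p0|pN0] := eqVneq (vnorm p) 0.
  by exists 0 => a; rewrite /vector_functional (vnorm_eq0 p0) hip0r mul0r.
have [q0|qN0] := eqVneq (vnorm q) 0.
  exists 1 => a; rewrite phiE mul1r /vector_functional (vnorm_eq0 q0) hip0r.
  by rewrite addr0.
set t := vnorm p ^+ 2 in pq.
have t0 : 0 < t by rewrite exprn_gt0// lt_neqAle eq_sym pN0 vnorm_ge0.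
have qt : vnorm q ^+ 2 = 1 - t by lra.
have t1 : 0 < 1 - t by rewrite -qt exprn_gt0// lt_neqAle eq_sym qN0 vnorm_ge0.
pose g (s : R) h a : R[i] := (s^-1)%:C%C * vector_functional h a.
have gl s h : scalar (g s h).
  by move=> z a b; rewrite /g vector_functional_scalar; ring.
have g0 s h a : 0 < s -> 0 <= g s h (cmul (cstar a) a).
  move=> s0; rewrite mulr_ge0 ?vector_functional_ge0// ler0c invr_ge0 ltW//.
have gb s h a : 0 < s -> vnorm h ^+ 2 = s -> vnorm a <= 1 -> cabs (g s h a) <= 1.
  move=> s0 hs a1; rewrite /g cabsM cabs_real gtr0_norm ?invr_gt0// mulrC.
  rewrite ler_pdivrMr// mul1r; apply: le_trans (vector_functional_bound _ _) _.
  by rewrite hs ler_piMl// ltW.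
have tC (s : R) : 0 < s -> s%:C%C * (s^-1)%:C%C = 1 :> R[i].
  by move=> s0; rewrite -rmorphM divff ?gt_eqF.
have phig a : phi a = t%:C%C * g t p a + (1 - t%:C%C) * g (1 - t) q a.
  have -> : 1 - t%:C%C = (1 - t)%:C%C by rewrite rmorphB rmorph1.
  by rewrite /g !mulrA !tC// !mul1r phiE.
have phig' a : phi a = (1 - t)%:C%C * g (1 - t) q a + (1 - (1 - t)%:C%C) * g t p a.
  by rewrite phig rmorphB rmorph1; ring.
have [|||gphi _] := phip (g t p) (g (1 - t) q) t%:C%C _ _ _ phig.
- apply: state_convex_component phig => //; first by apply/andP; split; lra.
  + by move=> a; apply: g0.
  + by move=> a; apply: gb.
  + by move=> a; apply: gb.
- apply: state_convex_component phig' => //; first by apply/andP; split; lra.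
  + by move=> a; apply: g0.
  + by move=> a; apply: gb.
  + by move=> a; apply: gb.
- by rewrite ltcR t0 -[1]/(1%:C%C) ltcR; lra.
by exists t => a; rewrite -gphi /g mulrA tC// mul1r.
Qed.

End Purity.

Lemma conj_i (R : realType) : ('i%C : R[i])^* = - 'i%C.
Proof. by apply/eqP; rewrite eq_complex /= oppr0 !eqxx. Qed.

Lemma mul_ii (R : realType) : 'i%C * 'i%C = -1 :> R[i].
Proof. by rewrite -expr2 sqr_i. Qed.

Lemma cabs_i (R : realType) : cabs ('i%C : R[i]) = 1.
Proof. by rewrite /cabs normc_def /= expr0n add0r expr1n sqrtr1. Qed.

Lemma converges_rep (R : realType) (D : cstarAlgType R) (H : hilbertType R)
    (sigma : representation D H) (a : D) (u : nat -> H) (l : H) :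
  converges u l -> converges (fun n => sigma a (u n)) (sigma a l).
Proof.
move=> ul e e0; have [M M0 aM] := rep_bound sigma a.
have [|N NP] := ul (e / (M + 1)); first by rewrite divr_gt0//; lra.
exists N => n /NP; rewrite -repB ltr_pdivlMr; last by lra.
have := aM (u n - l); have := vnorm_ge0 (u n - l); nra.
Qed.

(** * Consequences of purity: collinear vectors and approximate transitivity *)

Section Schur.
Context {R : realType} {D : cstarAlgType R} (sigma : spectrum D).
Let H := spec_space sigma.
Variable h0 : H.
Hypothesis h01 : vnorm h0 = 1.
Hypothesis h0_pure : pure_state (vector_functional h0).
Implicit Types (h k u v w : H) (a b m : D).

Lemma h0_neq0 : h0 != 0.
Proof.
by apply/eqP => h00; have /eqP := h01; rewrite h00 vnorm0 eq_sym oner_eq0.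
Qed.

(** By the parallelogram law phi is the sum of the functionals of (h0 + h1) / 2 and (h0 - h1) / 2,
    so [pure_split] makes the first one t phi; the cross terms in its expansion are then (4 t - 2)
    phi. *)
Lemma equal_state_cross h1 : vnorm h1 = 1 ->
  (forall a, vector_functional h1 a = vector_functional h0 a) ->
  exists r : R, forall a, hip (sigma a h1) h0 + hip (sigma a h0) h1
                          = r%:C%C * vector_functional h0 a.
Proof.
move=> h11 h1E; pose c : R[i] := (2^-1)%:C%C.
have cc : c^* = c by rewrite conj_ReC.
have cE : c = 2^-1 by rewrite /c fmorphV rmorph_nat.
have [||t tP] := pure_split (p := c *: (h0 + h1)) (q := c *: (h0 - h1)) h0_pure.
- move=> a; have := h1E a; rewrite /vector_functional !repZ repD repB.
  rewrite !(hipZl, hipZr) cc !(hipDl, hipNl, hipDr, hipNr) => E; rewrite E.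
  rewrite cE. by field.
- rewrite !vnormZ cabs_real gtr0_norm ?invr_gt0// !exprMn -mulrDr.
  rewrite vnorm_sqD vnorm_sqB h01 h11. by field.
exists (4 * t - 2) => a; have := tP a; have := h1E a.
rewrite /vector_functional repZ repD hipZl hipZr cc !(hipDl, hipDr) => -> E.
by rewrite rmorphB rmorphM !rmorph_nat mulrBl -mulrA -E cE; field.
Qed.

(** Polarisation: [equal_state_cross] for h1 and for i h1 gives the sum and the difference of the
    cross terms, hence <a h1, h0> = z phi(a) for all a, and cyclicity of h0 concludes. *)
Lemma equal_state_collinear h1 : vnorm h1 = 1 ->
  (forall a, vector_functional h1 a = vector_functional h0 a) ->
  exists z : R[i], h1 = z *: h0.
Proof.
move=> h11 h1E; have [r rP] := equal_state_cross h11 h1E.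
have [||s sP] := @equal_state_cross ('i%C *: h1).
- by rewrite vnormZ cabs_i mul1r.
- move=> a; rewrite -h1E /vector_functional repZ hipZl hipZr conj_i mulrA.
  by rewrite mulrN mul_ii opprK mul1r.
pose z : R[i] := (r%:C%C - 'i%C * s%:C%C) / 2; exists z.
have zP a : hip (sigma a h1) h0 = z * vector_functional h0 a.
  have := rP a; have := sP a; rewrite repZ hipZl hipZr conj_i => E1 E2.
  rewrite /z mulrAC mulrBl -mulrA -E1 -E2 mulrDr mulNr mulrN !mulrA mul_ii.
  by field.
apply/eqP; rewrite -subr_eq0; apply/eqP.
apply: (cyclic_orthogonal (spec_irr sigma) h0_neq0) => a.
by rewrite rep_starr repB repZ hipBl hipZl zP subrr.
Qed.

(** Purity is assumed of h0 only, so the claim is carried there: if b_n u tends to h0, then b_n v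
    has the same inner products and tends to some h1 with the state of h0; the relation h1 = z h0 is
    carried back through b_n. *)
Lemma equal_functional_collinear u v : u != 0 ->
  (forall a, vector_functional u a = vector_functional v a) ->
  exists z : R[i], v = z *: u.
Proof.
move=> uN0 uv.
have uvE a b : hip (sigma a u) (sigma b u) = hip (sigma a v) (sigma b v).
  by rewrite !rep_starr -!rep_mul; apply: uv.
have [b bu] := cyclic_sequence (spec_irr sigma) h0 uN0.
have [e e0|h1 bv] := complete_vnorm (u := fun n => sigma (b n) v).
  have [N NP] := converges_cauchy bu e0.
  exists N => m n Nm Nn; have := NP m n Nm Nn.
  rewrite -!repBa -[in X in _ -> X](@ltr_pXn2r _ 2) ?nnegrE ?vnorm_ge0 ?ltW//.
  rewrite -[in X in X -> _](@ltr_pXn2r _ 2) ?nnegrE ?vnorm_ge0 ?ltW//.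
  by rewrite -!Re_hip uvE.
have limE a : hip (sigma a h1) h1 = hip (sigma a h0) h0.
  apply: (hip_limit_eq2 (converges_rep sigma a bv) bv (converges_rep sigma a bu) bu).
  by move=> n; rewrite -!rep_mul uvE.
have [|//|z h1E] := @equal_state_collinear h1.
  have : hip h1 h1 = hip h0 h0.
    by apply: (hip_limit_eq2 bv bv bu bu) => n; rewrite uvE.
  rewrite !hip_vnorm h01 expr1n => /complexI/eqP.
  by rewrite sqrp_eq1 ?vnorm_ge0// => /eqP.
have zE : z^* *: v = u.
  apply/eqP; rewrite -subr_eq0; apply/eqP.
  apply: (cyclic_orthogonal (spec_irr sigma) h0_neq0) => a.
  rewrite rep_starr hip_conj repB repZ hipBr hipZr conjCK -hipZl -h1E.
  apply/eqP; rewrite conjC_eq0 subr_eq0; apply/eqP.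
  apply: (hip_limit_eq2 bv (converges_cst _) bu (converges_cst _)) => n.
  by rewrite uvE.
have zN0 : z^* != 0.
  by apply/eqP => z0; move: uN0; rewrite -zE z0 scale0r eqxx.
by exists (z^*)^-1; rewrite -zE scalerA mulVf// scale1r.
Qed.

(* The hypothesis says that h0 + i w and h0 - i w define the same functional. *)
Lemma hermitian_collinear w :
  (forall m, hip (sigma m h0) w = hip (sigma m w) h0) ->
  exists z : R[i], w = z *: h0.
Proof.
move=> wE; have ii := mul_ii R.
have iw : w = - 'i%C *: ('i%C *: w) by rewrite scalerA mulNr ii opprK scale1r.
have [uv0|uvN0] := eqVneq (h0 + 'i%C *: w) 0.
  exists 'i%C; rewrite iw -[h0](addrK ('i%C *: w)) uv0 sub0r.
  by rewrite scaleNr scalerN.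
have [|z zE] := @equal_functional_collinear _ (h0 - 'i%C *: w) uvN0.
  move=> a; rewrite /vector_functional repB repD repZ.
  rewrite !(hipDl, hipNl, hipDr, hipNr, hipZl, hipZr) conj_i wE.
  ring.
have {}zE : (1 - z) *: h0 = ((1 + z) * 'i%C) *: w.
  rewrite -scalerA scalerBl scalerDl !scale1r -{1}[h0](subrK ('i%C *: w)) zE.
  by rewrite scalerDr addrAC [_ - z *: h0]addrAC subrr add0r addrC.
(* If 1 + z = 0, the coefficient 1 - z is 2 and h0 would be zero. *)
have [z1|zN1] := eqVneq (1 + z) 0.
  move: zE; rewrite z1 mul0r scale0r => /eqP; rewrite scaler_eq0 (negbTE h0_neq0).
  rewrite orbF => /eqP z1'; have : (1 + z) + (1 - z) = 0 by rewrite z1 z1' addr0.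
  by rewrite addrACA subrr addr0 => /eqP; rewrite -[1 + 1]/(2%:R) pnatr_eq0.
have c0 : (1 + z) * 'i%C != 0.
  by rewrite mulf_neq0//; apply/eqP => i0; have /eqP := ii; rewrite i0 mul0r
    eq_sym oppr_eq0 oner_eq0.
exists (((1 + z) * 'i%C)^-1 * (1 - z)).
by rewrite -scalerA zE scalerA mulVf// scale1r.
Qed.

(** The vector u is recovered from v + u and i (u - v), which both satisfy the symmetric hypothesis
    of [hermitian_collinear]. *)
Lemma cross_collinear u v :
  (forall m, hip (sigma m h0) u = hip (sigma m v) h0) ->
  exists z : R[i], u = z *: h0.
Proof.
move=> uv; have ii := mul_ii R.
have vu m : hip (sigma m u) h0 = hip (sigma m h0) v.
  by rewrite hip_conj rep_starr uv -hip_conj -rep_star.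
have [|z zE] := @hermitian_collinear (v + u).
  by move=> m; rewrite repD hipDr hipDl uv vu addrC.
have [|y yE] := @hermitian_collinear ('i%C *: (u - v)).
  by move=> m; rewrite repZ repB hipZr hipZl hipBr hipBl uv vu conj_i; ring.
exists (2^-1 * (z - 'i%C * y)).
have i2 (x : H) : 'i%C *: ('i%C *: x) = - x by rewrite scalerA ii scaleN1r.
rewrite -scalerA scalerBl -scalerA -zE -yE i2 opprK.
have u2 : u + u = (2 : R[i]) *: u by rewrite scaler_nat mulr2n.
rewrite [v + u]addrC addrACA subrr addr0 u2 scalerA.
by rewrite mulVf ?scale1r// pnatr_eq0.
Qed.

(** [riesz] for m |-> m h0 and m |-> m^* h0 gives limits u1 of b_n h0 and u2 of b_n^* h0. The
    residual v - u1 and u2 satisfy the hypothesis of [cross_collinear], so they are z h0 and conj(z)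
    h0; it remains to see that z = 0. *)
Lemma transitive_pair v (e : R) : hip v h0 = 0 -> 0 < e ->
  exists m, vnorm (sigma m h0 - v) < e /\ vnorm (sigma (cstar m) h0) < e.
Proof.
move=> v0 e0.
have [|||||b [u1 [u2 [bu1 bu2 vE]]]] := @riesz R D H (sigma ^~ h0)
  (fun m => sigma (cstar m) h0) (fun m => hip (sigma m h0) v) (vnorm v ^+ 2).
- by move=> z x y; rewrite repDa repZa.
- by move=> z x y; rewrite cstarD cstarZ repDa repZa.
- by move=> z x y; rewrite repDa repZa hipDl hipZl.
- exact: sqr_ge0.
- move=> x; rewrite mulrDr; apply: ler_wpDr; first by rewrite mulr_ge0 ?sqr_ge0.
  rewrite -exprMn ler_pXn2r ?nnegrE ?mulr_ge0 ?cabs_ge0 ?vnorm_ge0//.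
  by rewrite [leRHS]mulrC cauchy_schwarz.
have cross m : hip (sigma m h0) (v - u1) = hip (sigma m u2) h0.
  by rewrite hipBr vE addrC addKr -rep_star.
have [z zE] := cross_collinear cross.
have u2E : u2 = z^* *: h0.
  apply/eqP; rewrite -subr_eq0; apply/eqP.
  apply: (cyclic_orthogonal (spec_irr sigma) h0_neq0) => m.
  by rewrite rep_starr repB repZ hipBl hipZl -cross zE hipZr subrr.
have h0h0 : hip h0 h0 = 1 by rewrite hip_vnorm h01 expr1n.
have u12 : hip u1 h0 = hip h0 u2.
  apply: (hip_limit_eq2 bu1 (converges_cst _) (converges_cst _) bu2) => n.
  by rewrite /= rep_star.
(* As v is orthogonal to h0 and <u1, h0> = <h0, u2> = z, the product <v - u1, h0> is -z; but v - u1
   = z h0 makes it z. *)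
have z0 : z = 0.
  have : hip (v - u1) h0 = z by rewrite zE hipZl h0h0 mulr1.
  rewrite hipBl v0 sub0r u12 u2E hipZr h0h0 conjCK mulr1 => /eqP.
  by rewrite -subr_eq0 -opprD oppr_eq0 -mulr2n mulrn_eq0 /= => /eqP.
have [N1 N1P] := bu1 e e0; have [N2 N2P] := bu2 e e0.
have u1v : u1 = v by apply/esym/eqP; rewrite -subr_eq0 zE z0 scale0r.
exists (b (maxn N1 N2)); split; first by rewrite -u1v; apply: N1P; rewrite leq_maxl.
have := N2P _ (leq_maxr N1 N2).
by rewrite u2E z0 conjC0 scale0r subr0.
Qed.

Lemma approximate_unit_at e : 0 < e :> R -> exists b, vnorm (sigma b h0 - h0) < e.
Proof.
move=> e0.
have [_ [b _ <-] be] := cyclic_approximable (spec_irr sigma) h0_neq0 h0 e0.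
by exists b.
Qed.

(* d = l + m + phi(d) b with l h0, m^* h0 and b h0 - h0 all small, and these
   three conditions are controlled by the values of phi. *)
Lemma almost_diagonal d (e : R) : 0 < e ->
  exists (s : seq D) (delta : R), 0 < delta /\
  forall (K : hilbertType R) (tau : representation D K) (k l : K),
    (forall a, a \in s -> cabs (hip (tau a k) k - vector_functional h0 a) < delta) ->
    (forall a, a \in s -> cabs (hip (tau a l) l - vector_functional h0 a) < delta) ->
    vnorm k = 1 -> vnorm l = 1 -> hip k l = 0 -> cabs (hip (tau d k) l) < e.
Proof.
move=> e0; set phi := vector_functional h0.
have [C C1 CE] : exists2 C, 1 <= C & C = 1 + cabs (phi d).
  by exists (1 + cabs (phi d)); rewrite ?lerDl ?cabs_ge0.
have C0 : 0 <= C by lra.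
(* The three terms of [dE] will be at most 2 C c, 2 c and 2 |phi(d)| c, together 4 C c < 7 C c =
   e. *)
have [c c0 cC] : exists2 c, 0 < c & c * (7 * C) = e.
  by exists (e / (7 * C)); rewrite ?divr_gt0 ?divfK ?gt_eqF//; lra.
have h0h0 : hip h0 h0 = 1 by rewrite hip_vnorm h01 expr1n.
have [b bP] := approximate_unit_at c0.
have [||m [m1 m2]] := @transitive_pair (sigma d h0 - phi d *: h0) c.
- by rewrite hipBl hipZl h0h0 mulr1 subrr.
- by [].
pose l' := d - phi d *: b - m.
have l'h0 : vnorm (sigma l' h0) <= C * c.
  rewrite !repBa repZa.
  rewrite [X in vnorm X](_ : _ = - (sigma m h0 - (sigma d h0 - phi d *: h0))
    - phi d *: (sigma b h0 - h0)); last first.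
    by rewrite scalerBr !opprB addrACA subrK [- sigma m h0 + _]addrC addrA.
  apply: le_trans (vnormD _ _) _; rewrite !vnormN vnormZ.
  have := cabs_ge0 (phi d); rewrite CE; nra.
(* The first two elements together control |b k - k|, the third |l' k| and the fourth |m^* l|; the
   tolerance is a square because squared norms are compared. *)
exists [:: cmul (cstar b) b; b; cmul (cstar l') l'; cmul m (cstar m)], (c ^+ 2).
split; first exact: exprn_gt0.
move=> K tau k l kP lP k1 l1 kl.
have vsq (x : D) (p : K) : cabs (hip (tau (cmul (cstar x) x) p) p
      - phi (cmul (cstar x) x)) < c ^+ 2 ->
    vnorm (tau x p) ^+ 2 <= vnorm (sigma x h0) ^+ 2 + c ^+ 2.
  rewrite -vnorm_rep_sq /phi /vector_functional -vnorm_rep_sq -rmorphB cabs_real.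
  by have := ler_norm (vnorm (tau x p) ^+ 2 - vnorm (sigma x h0) ^+ 2); lra.
have cge0 := ltW c0.
have dk : vnorm (tau l' k) <= 2 * C * c.
  rewrite -(@ler_pXn2r _ 2) ?nnegrE ?mulr_ge0 ?vnorm_ge0//.
  apply: le_trans (vsq _ _ (kP _ _)) _; first by rewrite !inE eqxx !orbT.
  have : vnorm (sigma l' h0) ^+ 2 <= (C * c) ^+ 2.
    by rewrite ler_pXn2r ?nnegrE ?mulr_ge0 ?vnorm_ge0.
  have : c ^+ 2 <= (C * c) ^+ 2.
    by rewrite ler_pXn2r ?nnegrE ?mulr_ge0// ler_peMl.
  rewrite [(2 * C * c) ^+ 2](_ : _ = 4 * (C * c) ^+ 2); last by ring.
  have := sqr_ge0 (C * c); lra.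
have ml : vnorm (tau (cstar m) l) <= 2 * c.
  rewrite -(@ler_pXn2r _ 2) ?nnegrE ?mulr_ge0 ?vnorm_ge0//.
  have := vsq (cstar m) l; rewrite (cstarK m) => /(_ (lP _ _)).
  rewrite !inE eqxx !orbT => /(_ isT).
  have : vnorm (sigma (cstar m) h0) ^+ 2 <= c ^+ 2.
    by rewrite ler_pXn2r ?nnegrE ?vnorm_ge0// ltW.
  have := sqr_ge0 c; rewrite exprMn; lra.
have re (p q : R[i]) : cabs (p - q) < c ^+ 2 -> complex.Re q - c ^+ 2 <= complex.Re p.
  have := Re_le (q - p); rewrite cabsC ReD ReN; lra.
have bk : vnorm (tau b k - k) <= 2 * c.
  rewrite -(@ler_pXn2r _ 2) ?nnegrE ?mulr_ge0 ?vnorm_ge0//.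
  have b1 := vsq b k (kP _ (mem_head _ _)).
  have b2 : complex.Re (hip (sigma b h0) h0) - c ^+ 2 <= complex.Re (hip (tau b k) k).
    by apply: re; apply: kP; rewrite !inE eqxx orbT.
  have : vnorm (sigma b h0 - h0) ^+ 2 <= c ^+ 2.
    by rewrite ler_pXn2r ?nnegrE ?vnorm_ge0// ltW.
  rewrite !vnorm_sqB k1 h01 exprMn; lra.
have dE : hip (tau d k) l = hip (tau l' k) l + hip k (tau (cstar m) l)
    + phi d * hip (tau b k - k) l.
  by rewrite hipBl kl subr0 -rep_star !repBa repZa !hipBl hipZl; ring.
rewrite dE; apply: le_lt_trans (cabsD _ _) _.
have := cabsD (hip (tau l' k) l) (hip k (tau (cstar m) l)).
have := cauchy_schwarz (tau l' k) l; have := cauchy_schwarz k (tau (cstar m) l).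
have := cauchy_schwarz (tau b k - k) l; rewrite k1 l1 cabsM !mulr1 mul1r.
have := cabs_ge0 (phi d); move: cC bk ml dk; rewrite CE.
move: (cabs (phi d)) (vnorm (tau b k - k)) (cabs (hip (tau b k - k) l)) => x y z.
move=> cC bk ml dk x0 zy.
have : x * z <= x * (2 * c) by rewrite ler_wpM2l//; lra.
have := mulr_ge0 x0 cge0; lra.
Qed.

End Schur.

(** * Perturbation of Gram-Schmidt *)

(** Here delta is chosen before the space and the maps, so that one value serves all indices of a
    net. The last conclusion, recording that eta stays in the span of zeta, is there for the
    induction: it makes the new vectors orthogonal to the first one. *)
Lemma gram_schmidt (R : realType) (n : nat) (M e : R) : 0 <= M -> 0 < e ->
  exists2 delta : R, 0 < delta &
  forall (K : hilbertType R) (U : Type) (L : U -> K -> K) (psi : U -> R[i])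
    (zeta : 'I_n -> K),
    (forall u, linear (L u)) -> (forall u, cabs (psi u) <= M) ->
    (forall i j, cabs (hip (zeta i) (zeta j) - (i == j)%:R) < delta) ->
    (forall u i j, cabs (hip (L u (zeta i)) (zeta j) - (i == j)%:R * psi u)
                   < delta) ->
    exists eta : 'I_n -> K,
      [/\ Defs.orthonormal eta,
          forall u i, cabs (hip (L u (eta i)) (eta i) - psi u) < e &
          forall k, (forall i, hip (zeta i) k = 0) -> forall i, hip (eta i) k = 0].
Proof.
move=> M0 e0; elim: n => [|n [d' d'0 IH]].
  exists 1 => // K U L psi zeta _ _ _ _; exists zeta.
  by split => [[]|? []|k ?] //.
(* The bound 1 / 2 keeps |zeta_0|^2 away from 0. Once the components along zeta_0 are removed the
   entries are off by at most (2 M + 7) d, and normalising zeta_0 leaves an error of at most 2 (1 +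
   M) d. *)
pose d := Num.min (1 / 2) (Num.min (d' / (2 * M + 8)) (e / (4 * (1 + M)))).
have [dle1 dle2 dle3] : [/\ d <= 1 / 2, d * (2 * M + 8) <= d' & d * (4 * (1 + M)) <= e].
  rewrite -!ler_pdivlMr; try lra.
  by split; rewrite /d !ge_min lexx ?orbT.
have d0 : 0 < d.
  by rewrite /d !lt_min !divr_gt0//; lra.
clearbody d; exists d => // K U L psi zeta Ll psiM gram form.
set z0 := zeta ord0.
have q1 : `|vnorm z0 ^+ 2 - 1| < d.
  by have := gram ord0 ord0; rewrite eqxx hip_vnorm -[1%:R]/(1%:C%C) -rmorphB cabs_real.
have {q1} [q1 q2] : 1 - d < vnorm z0 ^+ 2 /\ vnorm z0 ^+ 2 < 1 + d.
  by move: q1; rewrite ltr_norml => /andP[]; lra.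
have [q qE] : exists q, q = vnorm z0 ^+ 2 by exists (vnorm z0 ^+ 2).
rewrite -qE in q1 q2.
have q0 : 0 < q by lra.
have v0 : 0 < vnorm z0.
  rewrite lt_neqAle vnorm_ge0 andbT eq_sym; apply: contra_eqN qE => /eqP ->.
  by rewrite expr0n /= gt_eqF.
have hz0 : hip z0 z0 = q%:C%C by rewrite hip_vnorm qE.
pose lam (j : 'I_n) : R[i] := (q^-1)%:C%C * hip (zeta (lift ord0 j)) z0.
have lamE j : cabs (lam j) <= 2 * d.
  have := gram (lift ord0 j) ord0; rewrite eq_sym eq_liftF subr0 /lam cabsM cabs_real.
  rewrite gtr0_norm ?invr_gt0// mulrC ler_pdivrMr//; nra.
pose zeta' (j : 'I_n) := zeta (lift ord0 j) - lam j *: z0.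
have zeta'0 j : hip (zeta' j) z0 = 0.
  rewrite /zeta' hipBl hipZl hz0 /lam mulrAC -rmorphM mulVf ?gt_eqF// mul1r.
  by rewrite subrr.
clearbody lam.
(* Used twice: with f = id and p = 1 for the Gram matrix, with f = L u and p = psi u for the forms;
   hence the common bound 1 + M. *)
have near (f : K -> K) (p : R[i]) : linear f -> cabs p <= 1 + M ->
    (forall i j, cabs (hip (f (zeta i)) (zeta j) - (i == j)%:R * p) < d) ->
    forall i j, cabs (hip (f (zeta' i)) (zeta' j) - (i == j)%:R * p) < d'.
  move=> fl pM fp i j.
  have Bij := fp (lift ord0 i) (lift ord0 j); rewrite (inj_eq lift_inj) in Bij.
  have B0j := fp ord0 (lift ord0 j); rewrite eq_liftF mul0r subr0 in B0j.
  have Bi0 := fp (lift ord0 i) ord0; rewrite eq_sym eq_liftF mul0r subr0 in Bi0.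
  have B00 := fp ord0 ord0; rewrite eqxx mul1r in B00.
  have {}B00 : cabs (hip (f z0) z0) <= 2 + M.
    by have := cabsD (hip (f z0) z0 - p) p; rewrite subrK; lra.
  rewrite /zeta' (linear_mapB fl) (linear_mapZ fl) hipBl !hipBr !hipZl !hipZr.
  rewrite [X in cabs X](_ : _ =
    (hip (f (zeta (lift ord0 i))) (zeta (lift ord0 j)) - (i == j)%:R * p)
    - (lam j)^* * hip (f (zeta (lift ord0 i))) z0
    - lam i * hip (f z0) (zeta (lift ord0 j))
    + lam i * (lam j)^* * hip (f z0) z0); last by ring.
  have c1 := cabsD ((hip (f (zeta (lift ord0 i))) (zeta (lift ord0 j))
    - (i == j)%:R * p) - (lam j)^* * hip (f (zeta (lift ord0 i))) z0
    - lam i * hip (f z0) (zeta (lift ord0 j))) (lam i * (lam j)^* * hip (f z0) z0).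
  have c2 := cabsB ((hip (f (zeta (lift ord0 i))) (zeta (lift ord0 j))
    - (i == j)%:R * p) - (lam j)^* * hip (f (zeta (lift ord0 i))) z0)
    (lam i * hip (f z0) (zeta (lift ord0 j))).
  have c3 := cabsB (hip (f (zeta (lift ord0 i))) (zeta (lift ord0 j))
    - (i == j)%:R * p) ((lam j)^* * hip (f (zeta (lift ord0 i))) z0).
  rewrite !cabsM cabs_conj in c1 c2 c3; apply: le_lt_trans c1 _.
  have p1 : cabs (lam j) * cabs (hip (f (zeta (lift ord0 i))) z0) <= d.
    by apply: le_trans (ler_pM _ _ (lamE j) (ltW Bi0)) _; rewrite ?cabs_ge0//; nra.
  have p2 : cabs (lam i) * cabs (hip (f z0) (zeta (lift ord0 j))) <= d.
    by apply: le_trans (ler_pM _ _ (lamE i) (ltW B0j)) _; rewrite ?cabs_ge0//; nra.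
  have p3 : cabs (lam i) * cabs (lam j) <= 2 * d.
    by apply: le_trans (ler_pM _ _ (lamE i) (lamE j)) _; rewrite ?cabs_ge0//; nra.
  have p4 : cabs (lam i) * cabs (lam j) * cabs (hip (f z0) z0) <= 2 * d * (2 + M).
    by apply: le_trans (ler_pM _ _ p3 B00) _; rewrite ?mulr_ge0 ?cabs_ge0.
  lra.
have [||eta' [on' form' orth']] := IH K U L psi zeta' Ll psiM.
- move=> i j; have := near id 1 _ _ _ i j; rewrite mulr1; apply => //.
    by rewrite cabs1; lra.
  by move=> i' j'; rewrite mulr1; apply: gram.
- by move=> u; apply: near => //; have := psiM u; lra.
pose e1 := ((vnorm z0)^-1)%:C%C *: z0.
have e1E (f : K -> K) : linear f -> hip (f e1) e1 = (q^-1)%:C%C * hip (f z0) z0.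
  move=> fl; rewrite /e1 (linear_mapZ fl) hipZl hipZr conj_ReC mulrA -rmorphM.
  by rewrite qE -invfM expr2.
have e1_orth i : hip (eta' i) e1 = 0.
  by rewrite hipZr orth' ?mulr0.
exists (fun i => oapp eta' e1 (unlift ord0 i)); split.
- move=> i j; case: (unliftP ord0 i) => [i'|] ->; case: (unliftP ord0 j) => [j'|] ->;
    rewrite ?liftK ?unlift_none /=.
  + by rewrite on' (inj_eq lift_inj).
  + by rewrite e1_orth.
  + by rewrite hip_conj e1_orth conjC0.
  + by rewrite (e1E id)// hz0 -rmorphM mulVf ?gt_eqF.
- move=> u i; case: (unliftP ord0 i) => [i' _|_] //=.
  rewrite e1E// [X in cabs X](_ : _ = (q^-1)%:C%C * ((hip (L u z0) z0 - psi u)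
    + (1 - q)%:C%C * psi u)); last first.
    rewrite rmorphB rmorph1 fmorphV; field.
    by apply/eqP => /complexI q00; rewrite q00 ltxx in q0.
  rewrite cabsM cabs_real gtr0_norm ?invr_gt0// mulrC ltr_pdivrMr//.
  apply: le_lt_trans (cabsD _ _) _; rewrite cabsM cabs_real.
  have := form u ord0 ord0; rewrite eqxx mul1r.
  have q1' : `|1 - q| <= d by rewrite ler_norml; apply/andP; split; lra.
  have := ler_pM (normr_ge0 _) (cabs_ge0 _) q1' (psiM u).
  by rewrite -/z0; nra.
- move=> k zk i; case: (unliftP ord0 i) => [i' _|_] /=.
    by apply: orth' => j; rewrite /zeta' hipBl hipZl !zk mulr0 subr0.
  by rewrite hipZl zk mulr0.
Qed.

(** * Transfer of upper multiplicity *)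

Section WeakStar.
Context {R : realType} {D : cstarAlgType R}.

Definition basic_weakstar_nbhd (s : seq D) (delta : R) : set (D -> R[i]^o) :=
  [set f | forall a, a \in s -> cabs (f a) < delta] `&` topological_dual.

Lemma topological_dual0 : topological_dual (fun _ : D => 0 : R[i]^o).
Proof.
by split => [z a b|]; [rewrite mulr0 addr0|exact: cst_continuous].
Qed.

Lemma basic_weakstar_open (s : seq D) (delta : R) : 0 < delta ->
  open ([set f | forall a, a \in s -> cabs (f a) < delta] : set {ptws D -> R[i]^o}).
Proof.
move=> delta0; elim: s => [|a s IH].
  by rewrite [X in open X](_ : _ = setT); [exact: openT|exact/seteqP].
rewrite [X in open X](_ : _ = (proj a) @^-1` (ball (0 : R[i]^o) delta%:C%C)
   `&` [set f : {ptws D -> R[i]^o} | forall a, a \in s -> cabs (f a) < delta]).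
  apply: openI IH; apply: open_comp; last exact: ball_open.
  by move=> f _; apply: proj_continuous.
apply/seteqP; split => f /=.
  move=> fs; split; last by move=> b bs; apply: fs; rewrite inE bs orbT.
  by rewrite -ball_normE /= sub0r normrN cabsE ltcR; apply: fs; rewrite mem_head.
move=> [fa fs] b; rewrite inE => /orP[/eqP ->|]; last exact: fs.
by move: fa; rewrite -ball_normE /= sub0r normrN cabsE ltcR.
Qed.

Lemma weakstar_nbhd0_basic (s : seq D) (delta : R) : 0 < delta ->
  weakstar_nbhd0 (basic_weakstar_nbhd s delta).
Proof.
move=> delta0; split; last first.
  by split; [move=> a _ /=; rewrite cabs0|exact: topological_dual0].
by eexists; first exact: (basic_weakstar_open s delta0).
Qed.

(** The basic sets generate a filter that converges pointwise to 0, so every open set of the product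
    topology containing 0 belongs to it. *)
Lemma basic_weakstar_sub (N : set (D -> R[i]^o)) : weakstar_nbhd0 N ->
  exists (s : seq D) (delta : R), 0 < delta /\ basic_weakstar_nbhd s delta `<=` N.
Proof.
move=> [[W Wo ->] [W0 _]].
pose B (x : seq D * R) := [set f : D -> R[i]^o | forall a, a \in x.1 -> cabs (f a) < x.2].
pose F := filter_from [set x : seq D * R | 0 < x.2] B.
have FF : Filter F.
  apply: filter_from_filter; first by exists ([::], 1) => /=.
  move=> [s d] [s' d'] /= d0 d'0; exists (s ++ s', Num.min d d') => /=.
    by rewrite lt_min d0.
  by move=> f /= fs; split => a as' /=;
    have := fs a; rewrite mem_cat as' ?orbT => /(_ isT);
    rewrite lt_min => /andP[].
have : {ptws, F --> (fun=> 0 : R[i]^o)}.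
  apply/pointwise_cvgP => a A /nbhs_vnormP[e e0 eA].
  exists ([:: a], e) => //= f /= fa; apply: eA; rewrite subr0.
  by apply: fa; rewrite mem_head.
move=> /(_ W); case; first by apply: open_nbhs_nbhs.
move=> [s d] /= d0 sW; exists s, d; split => // f [fs fd]; split => //.
exact: sW.
Qed.

End WeakStar.

(** * Transfer of orthonormal families along a net *)

Section Transfer.
Context {R : realType}.

Lemma vector_functional_continuous (D : cstarAlgType R) (sigma : spectrum D)
    (h : spec_space sigma) : continuous (vector_functional h : D -> R[i]^o).
Proof.
apply/continuousP_vnorm => a e e0; have h0 := sqr_ge0 (vnorm h).
exists (e / (vnorm h ^+ 2 + 1)) => [|b]; first by rewrite divr_gt0//; lra.
rewrite ltr_pdivlMr; last by lra.
have -> : vector_functional h b - vector_functional h a = vector_functional h (b - a).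
  by rewrite /vector_functional repBa hipBl.
have := vector_functional_bound h (b - a); rewrite -[cabs _]/(vnorm (_ : R[i]^o)).
have := vnorm_ge0 (b - a); nra.
Qed.

(** Weak* neighbourhoods contain only elements of the dual, so membership in one asks for this
    besides small values. *)
Lemma vector_functional_sub_dual (D : cstarAlgType R) (sigma tau : spectrum D)
    (h : spec_space sigma) (k : spec_space tau) :
  topological_dual (fun a => vector_functional h a - vector_functional k a : R[i]^o).
Proof.
split => [z a b|].
  by rewrite !vector_functional_scalar mulrBr opprD addrACA.
move=> a; apply: (@continuousB _ R[i]^o D); exact: vector_functional_continuous.
Qed.

Lemma almost_diagonal_seq (D : cstarAlgType R) (sigma : spectrum D)
    (h0 : spec_space sigma) (h01 : vnorm h0 = 1)
    (h0_pure : pure_state (vector_functional h0)) (ds : seq D) (e : R) : 0 < e ->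
  exists (s : seq D) (delta : R), 0 < delta /\
  forall (K : hilbertType R) (tau : representation D K) (n : nat) (eta : 'I_n -> K),
    (forall i a, a \in s ->
      cabs (hip (tau a (eta i)) (eta i) - vector_functional h0 a) < delta) ->
    Defs.orthonormal eta ->
    forall d i j, d \in ds ->
      cabs (hip (tau d (eta i)) (eta j) - (i == j)%:R * vector_functional h0 d) < e.
Proof.
move=> e0; elim: ds => [|d ds [s [delta [delta0 IH]]]].
  by exists [::], 1; split.
have [s' [delta' [delta'0 dP]]] := almost_diagonal h01 h0_pure d e0.
(* The diagonal entries for d are values of the vector states at d, so d itself is listed; s'
   handles its off-diagonal entries and s the rest of the list. *)
exists (d :: s ++ s'), (Num.min e (Num.min delta delta')); split.
  by rewrite !lt_min e0 delta0.
move=> K tau n eta close on b i j.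
have closed i' a : a \in d :: s ++ s' -> [/\
    cabs (hip (tau a (eta i')) (eta i') - vector_functional h0 a) < e,
    cabs (hip (tau a (eta i')) (eta i') - vector_functional h0 a) < delta &
    cabs (hip (tau a (eta i')) (eta i') - vector_functional h0 a) < delta'].
  by move=> /(close i'); rewrite !lt_min => /and3P[].
rewrite inE => /orP[/eqP ->|bds]; last first.
  apply: IH => // i' a as_.
  by have [|_ ? _] := closed i' a; rewrite ?inE ?mem_cat ?as_ ?orbT.
have [<-|ij] := eqVneq i j.
  by rewrite mul1r; have [|? _ _] := closed i d; rewrite ?mem_head.
have unit i' : vnorm (eta i') = 1.
  have := on i' i'; rewrite eqxx hip_vnorm => /complexI/eqP.
  by rewrite sqrp_eq1 ?vnorm_ge0// => /eqP.
rewrite mul0r subr0; apply: dP => //; last by rewrite on (negbTE ij).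
- by move=> a as'; have [|_ _ ?] := closed i a; rewrite ?inE ?mem_cat ?as' ?orbT.
- by move=> a as'; have [|_ _ ?] := closed j a; rewrite ?inE ?mem_cat ?as' ?orbT.
Qed.

Section Net.
Context {D E : cstarAlgType R} (sigma : spectrum D) (rho : spectrum E).
Variables (h0 : spec_space sigma) (k0 : spec_space rho).
Hypothesis h01 : vnorm h0 = 1.
Hypothesis h0_pure : pure_state (vector_functional h0).
Let phi := vector_functional h0.
Let psi := vector_functional k0.

(* T plays the role of h |-> x (x) h for a suitable x in the bimodule, for which
   c = <x, x> and beta a = <x, a x>. *)
Definition compresses (tau : spectrum D) (ups : spectrum E) (c : D) (beta : E -> D) :=
  exists T : spec_space tau -> spec_space ups,
    (forall h k, hip (T h) (T k) = hip (tau c h) k) /\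
    (forall a h k, hip (ups a (T h)) (T k) = hip (tau (beta a) h) k).

Variables (I : Type) (sigma_ : I -> spectrum D) (rho_ : I -> spectrum E).
Hypothesis approx : forall (s : seq E) (e : R), 0 < e ->
  exists (c : D) (beta : E -> D),
    [/\ cabs (phi c - 1) < e,
        forall a, a \in s -> cabs (phi (beta a) - psi a) < e &
        forall i, compresses (sigma_ i) (rho_ i) c beta].

Definition has_family (F : cstarAlgType R) (tau : spectrum F) (f : F -> R[i])
    (N : set (F -> R[i]^o)) (n : nat) :=
  exists e : 'I_n -> spec_space tau, Defs.orthonormal e /\ forall i, Vec f N (e i).

(** In [approx], c and beta come before the index and only T depends on i; this is why one N' works
    for the whole net. It does depend on n, through [gram_schmidt]. *)
Lemma transfer_family (N : set (E -> R[i]^o)) (n : nat) : weakstar_nbhd0 N ->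
  exists2 N' : set (D -> R[i]^o), weakstar_nbhd0 N' &
  forall i, has_family (sigma_ i) phi N' n -> has_family (rho_ i) psi N n.
Proof.
move=> /basic_weakstar_sub[s [e [e0 sN]]].
have [M M0 psiM] : exists2 M : R, 0 <= M & forall a, a \in s -> cabs (psi a) <= M.
  elim: (s) => [|a s' [M M0 IH]]; first by exists 0.
  exists (Num.max M (cabs (psi a))); first by rewrite le_max M0.
  move=> b; rewrite inE => /orP[/eqP ->|/IH bM]; first by rewrite le_max lexx orbT.
  by rewrite le_max bM.
have [d d0 gs] := gram_schmidt n M0 e0.
(* One half pays for almost diagonality, the other for phi(c) close to 1 and phi(beta a) close to
   psi(a). *)
have d20 : 0 < d / 2 by lra.
have [c [beta [c1 betaP comp]]] := approx s d20.
have [s' [d' [d'0 diag]]] :=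
  almost_diagonal_seq h01 h0_pure (c :: map beta s) d20.
exists (basic_weakstar_nbhd s' d'); first exact: weakstar_nbhd0_basic.
move=> i [eta [on close]]; have [T [T1 T2]] := comp i.
have {}diag b j k : b \in c :: map beta s ->
    cabs (hip (sigma_ i b (eta j)) (eta k) - (j == k)%:R * phi b) < d / 2.
  by apply: diag => // j' a as'; have [_ [+ _]] := close j'; apply.
(* The operators are indexed by the elements of s alone, where psi is bounded by M. *)
have [|||| xi [on' form _]] := gs _ {a : E | a \in s} (fun u => rho_ i (sval u))
    (fun u => psi (sval u)) (T \o eta).
- by move=> u; exact: rep_linear.
- by move=> [a as_] /=; apply: psiM.
- move=> j k /=; rewrite T1.
  have := diag c j k (mem_head _ _); have [_|_] := eqVneq j k.
    rewrite mul1r => dc; rewrite -[_ - 1%:R](subrKA (phi c)).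
    by apply: le_lt_trans (cabsD _ _) _; lra.
  by rewrite mul0r; lra.
- move=> [a as_] j k /=; rewrite T2.
  have := diag (beta a) j k; rewrite inE map_f// orbT => /(_ isT).
  have [_|_] := eqVneq j k; last by rewrite !mul0r; lra.
  have := betaP a as_; rewrite !mul1r => ba dc.
  rewrite -[_ - psi a](subrKA (phi (beta a))).
  by apply: le_lt_trans (cabsD _ _) _; lra.
exists xi; split => // j; split.
  apply/eqP; have := on' j j; rewrite eqxx hip_norm => /eqP.
  by rewrite sqrp_eq1.
apply: sN; split; last exact: vector_functional_sub_dual.
by move=> a as_; apply: (form (exist _ a as_)).
Qed.

Lemma has_family_le (F : cstarAlgType R) (tau : spectrum F) (f : F -> R[i])
    (N : set (F -> R[i]^o)) (m n : nat) : (m <= n)%N ->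
  has_family tau f N n -> has_family tau f N m.
Proof.
move=> mn [e [on eN]]; exists (e \o widen_ord mn); split => [i j|i] /=; last exact: eN.
by rewrite on.
Qed.

Lemma vec_dim_ge (F : cstarAlgType R) (tau : spectrum F) (f : F -> R[i])
    (N : set (F -> R[i]^o)) (n : nat) : has_family tau f N n ->
  (n%:R%:E <= vec_dim tau f N)%E.
Proof. by move=> fam; apply: ereal_sup_ubound; exists n. Qed.

Lemma vec_dim_le (F : cstarAlgType R) (tau : spectrum F) (f : F -> R[i])
    (N : set (F -> R[i]^o)) (n : nat) : ~ has_family tau f N n.+1 ->
  (vec_dim tau f N <= n%:R%:E)%E.
Proof.
move=> nfam; apply: ge_ereal_sup => _ [m fam <-]; rewrite lee_fin ler_nat leqNgt.
by apply/negP => nm; apply: nfam; apply: has_family_le nm fam.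
Qed.

(** As N' depends on the family size, a size must be fixed first. If the supremum S over a tail of
    [rho_] is finite, let n be the largest size occurring there; N' for n + 1 excludes families of
    that size from the same tail of [sigma_], which is thus bounded by n <= S. *)
Lemma transfer_upper_mult (le : I -> I -> Prop) (le_refl : forall i, le i i) :
  (upper_mult le phi sigma_ <= upper_mult le psi rho_)%E.
Proof.
apply: le_ereal_inf_tmp => _ [N Nnbhd <-].
apply: le_ereal_inf_tmp => _ [i _ <-].
set S := ereal_sup _.
have vdS j n : le i j -> has_family (rho_ j) psi N n -> (n%:R%:E <= S)%E.
  move=> ij fam; apply: le_trans (vec_dim_ge fam) _.
  by apply: ereal_sup_ubound; exists j.
pose P n := `[< exists2 j, le i j & has_family (rho_ j) psi N n >].
(* The empty family makes 0 an admissible size, so a maximum exists even if no vector qualifies. *)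
have P0 : P 0%N.
  by apply/asboolP; exists i => //; exists (fun j => 0); split; case.
have [Sy|SNy] := eqVneq S +oo%E; first by rewrite Sy leey.
have [b Pb] : exists b, forall n, P n -> (n <= b)%N.
  case: S SNy vdS => [x| |] // _ vdS; last first.
    exists 0%N => n /asboolP[j ij fam]; have := vdS j n ij fam.
    by rewrite leNgt ltNyr.
  exists (Num.trunc x).+1 => n /asboolP[j ij fam]; have := vdS j n ij fam.
  rewrite lee_fin => nx; rewrite -(@ler_nat R); apply: le_trans nx _.
  exact/ltW/truncnS_gt.
have exP : exists n, P n by exists 0%N.
have [n /asboolP[j ij fam] nmax] := ex_maxnP exP Pb.
apply: le_trans (vdS j n ij fam).
have [N' N'nbhd N'P] := transfer_family n.+1 Nnbhd.
apply: ge_ereal_inf; exists (net_limsup le (fun j => vec_dim (sigma_ j) phi N')).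
  by exists N'.
apply: ge_ereal_inf; eexists; first by exists i.
apply: ge_ereal_sup => _ [k /= ik <-]; apply: vec_dim_le => /N'P fam'.
suff /nmax : P n.+1 by rewrite ltnn.
by apply/asboolP; exists k.
Qed.

End Net.
End Transfer.

(** * Induced representations *)

Lemma vector_functional_near (R : realType) (D : cstarAlgType R)
    (sigma : spectrum D) (h : spec_space sigma) (s : seq D) (e : R) :
  vnorm h = 1 -> 0 < e ->
  exists2 d : R, 0 < d & forall u : spec_space sigma, vnorm (u - h) < d ->
    cabs (hip u u - 1) < e /\
    forall a, a \in s -> cabs (vector_functional u a - vector_functional h a) < e.
Proof.
move=> h1 e0.
have [M M0 sM] : exists2 M : R, 0 <= M & forall a, a \in s -> vnorm a <= M.
  elim: s => [|a s [M M0 IH]]; first by exists 0.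
  exists (Num.max M (vnorm a)); first by rewrite le_max M0.
  move=> b; rewrite inE => /orP[/eqP ->|/IH bM]; first by rewrite le_max lexx orbT.
  by rewrite le_max bM.
(* Since |u| <= 2, both kinds of error are at most 3 (M + 1) d. *)
have [d [d0 d1 de]] : exists d, [/\ 0 < d, d <= 1 & 3 * (M + 1) * d < e].
  exists (Num.min 1 (e / (4 * (M + 1)))); split.
  - by rewrite lt_min ltr01 divr_gt0//; lra.
  - by rewrite ge_min lexx.
  - have le4 : Num.min 1 (e / (4 * (M + 1))) <= e / (4 * (M + 1)).
      by rewrite ge_min lexx orbT.
    move: le4; rewrite ler_pdivlMr; last by lra.
    move: (Num.min _ _) => m; lra.
exists d => // u ud.
have u2 : vnorm u <= 2 by have := vnormD (u - h) h; rewrite subrK; lra.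
have u0 := vnorm_ge0 u; have ud0 := vnorm_ge0 (u - h).
split=> [|a /sM aM].
  have -> : 1 = hip h h by rewrite hip_vnorm h1 expr1n.
  apply: le_lt_trans (hip_bound _ _ _ _) _; rewrite h1 mul1r.
  move: (vnorm u) (vnorm (u - h)) u2 u0 ud ud0 => x y; nra.
apply: le_lt_trans (hip_bound _ _ _ _) _; rewrite -repB.
have := rep_contraction sigma a (u - h); have := rep_contraction sigma a h.
rewrite h1 mulr1 => ah auh; have a0 := vnorm_ge0 a.
have auh' : vnorm (sigma a (u - h)) <= M * d.
  by apply: le_trans auh _; apply: ler_pM => //; lra.
have p1 : vnorm (sigma a (u - h)) * vnorm u <= M * d * 2.
  by apply: ler_pM => //; exact: vnorm_ge0.
have p2 : vnorm (sigma a h) * vnorm (u - h) <= M * d.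
  by apply: ler_pM => //; [exact: vnorm_ge0|lra|lra].
lra.
Qed.

Section Induced.
Context {R : realType} {A B : cstarAlgType R} (X : imprimitivityBimodule A B).

Section Tensor.
Context {H K : hilbertType R} (pi : representation B H) (rho : representation A K).
Variable t : X -> H -> K.
Hypothesis tlx : forall h, linear (t ^~ h).
Hypothesis tlh : forall x, linear (t x).
Hypothesis t_bal : forall x b h, t (ract (ib_right X) x b) h = t x (pi b h).
Hypothesis t_hip : forall x y h k,
  hip (t x h) (t y k) = hip (pi (rip (ib_right X) y x) h) k.
Hypothesis t_dense : dense (lin_span [set t x h | x in setT & h in setT]).
Hypothesis t_rho : forall a x h, rho a (t x h) = t (lact (ib_left X) a x) h.

Lemma tensor_eq0 k : (forall x h, hip k (t x h) = 0) -> k = 0.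
Proof.
move=> kt; apply: (dense_orthogonal (dense_approximable t_dense)).
by apply: lin_span_orthogonal => _ [x _ [h _ <-]].
Qed.

Lemma tensor_bound x h :
  vnorm (t x h) ^+ 2 <= vnorm (rip (ib_right X) x x) * vnorm h ^+ 2.
Proof.
rewrite -Re_hip t_hip; apply: le_trans (Re_le _) _.
apply: le_trans (cauchy_schwarz _ _) _; rewrite expr2 mulrA.
by apply: ler_wpM2r; [exact: vnorm_ge0|exact: rep_contraction].
Qed.

(** With f = id and g = 0, [riesz] is the ordinary Riesz theorem; [tensor_bound] supplies the
    boundedness. *)
Lemma tensor_adjoint x k : exists y, forall h, hip (t x h) k = hip h y.
Proof.
pose C := vnorm (rip (ib_right X) x x) * vnorm k ^+ 2.
have [|||||_ [y [z [_ _ yE]]]] := @riesz R H H id (fun=> 0)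
  (fun h => hip (t x h) k) C.
- by [].
- by move=> *; rewrite scaler0 addr0.
- by move=> z u v; rewrite tlh hipDl hipZl.
- by rewrite mulr_ge0 ?sqr_ge0 ?vnorm_ge0.
- move=> h; rewrite vnorm0 expr0n addr0 /=.
  apply: (@le_trans _ _ ((vnorm (t x h) * vnorm k) ^+ 2)).
    by rewrite ler_pXn2r ?nnegrE ?mulr_ge0 ?cabs_ge0 ?vnorm_ge0// cauchy_schwarz.
  rewrite exprMn /C [leRHS]mulrAC.
  by apply: ler_wpM2r; [exact: sqr_ge0|exact: tensor_bound].
by exists y => h; rewrite yE hip0r addr0.
Qed.

(** Writing T_x for [t x], this is T_z T_x^* = rho(<z, x>): tested against [t w h], the
    compatibility of the two inner products turns x <z, w> into <x, z> w. *)
Lemma tensor_of_adjoint z x k y : (forall h, hip (t x h) k = hip h y) ->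
  t z y = rho (lip (ib_left X) z x) k.
Proof.
move=> yE; apply/eqP; rewrite -subr_eq0; apply/eqP/tensor_eq0 => w h.
rewrite hipBl t_hip rep_star (rip_star (ib_right X) w z) hip_conj -yE -t_bal -ib_compat.
by rewrite -t_rho -hip_conj rep_starr (lip_star (ib_left X) x z) subrr.
Qed.

(** The range is an invariant subspace. Were it zero, all pi(<x, y>) would kill h; their arguments
    span a dense subspace by fullness, so this contradicts nondegeneracy. *)
Lemma tensor_approximable h : irreducible pi -> irreducible rho -> h != 0 ->
  approximable (range (t ^~ h)).
Proof.
move=> pi_irr rho_irr hN0; apply: (invariant_approximable rho_irr).
- split; first by exists 0 => //; rewrite (linear_map0 (tlx h)).
  by move=> z _ _ [x _ <-] [y _ <-]; exists (z *: x + y) => //; rewrite tlx.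
- by move=> a _ [x _ <-]; exists (lact (ib_left X) a x); rewrite ?t_rho.
apply: contrapT => tx.
have {}tx x : t x h = 0.
  by apply/eqP; apply: contrapT => /negP txN0; apply: tx; exists (t x h) => //; exists x.
have pixy v : [set rip (ib_right X) x y | x in setT & y in setT] v -> pi v h = 0.
  move=> [x _ [y _ <-]]; apply: hip_eq0.
  by rewrite -t_hip tx hip0l.
have [b] := rep_nondegenerate pi_irr hN0.
case/eqP; apply: vnorm_eq0; apply/eqP; rewrite eq_le vnorm_ge0 andbT.
apply/ler_addgt0Pl => e e0; rewrite addr0.
have h0 := vnorm_ge0 h.
have [|v [n [c [s [sP ->]]]] vb] :=
  dense_approximable (ib_right_full X) b (e := e / (vnorm h + 1)).
  by rewrite divr_gt0//; lra.
set v' := \sum_(i < n) _ in vb.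
have v'h : pi v' h = 0.
  rewrite /v' (linear_map_sum (rep_linear_alg pi h)) big1// => i _.
  by rewrite repZa pixy ?scaler0.
have := rep_contraction pi (v' - b) h; rewrite repBa v'h sub0r vnormN.
move: vb; rewrite ltr_pdivlMr; last by lra.
have := vnorm_ge0 (v' - b); nra.
Qed.

(** The set consists of the vectors T_x^* k. It is invariant because pi(b) T_x^* is the adjoint of
    T_y for y = x b^*, and nonzero because k is not orthogonal to all tensors. *)
Lemma adjoint_approximable k : irreducible pi -> k != 0 ->
  approximable [set y | exists x, forall h, hip (t x h) k = hip h y].
Proof.
move=> pi_irr kN0; apply: (invariant_approximable pi_irr).
- split.
    by exists 0 => h; rewrite (linear_map0 (tlx h)) hip0l hip0r.
  (* The adjoint is conjugate-linear in x, whence the conjugate of z. *)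
  move=> z y y' [x xE] [x' x'E]; exists (z^* *: x + x') => h.
  by rewrite tlx hipDl hipZl xE x'E hipDr hipZr.
- move=> b y [x xE]; exists (ract (ib_right X) x (cstar b)) => h.
  by rewrite t_bal xE -rep_starr.
apply: contrapT => yN; case/eqP: kN0; apply: tensor_eq0 => x h.
have [y yE] := tensor_adjoint x k.
rewrite hip_conj yE; have [->|yN0] := eqVneq y 0; first by rewrite hip0r conjC0.
by case: yN; exists y => //; exists x.
Qed.

End Tensor.

Lemma compresses_induced (pi : spectrum B) (rho : spectrum A) x :
  is_induced X pi rho ->
  compresses pi rho (rip (ib_right X) x x)
    (fun a => rip (ib_right X) x (lact (ib_left X) a x)).
Proof.
move=> [t [_ _ t_hip _ t_rho]]; exists (t x); split => [h k|a h k].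
  exact: t_hip.
by rewrite t_rho t_hip.
Qed.

(** Here the compressing map is T_x^*; the products T_x T_x^* and T_x pi(b) T_x^* = T_{xb} T_x^* are
    given by [tensor_of_adjoint]. *)
Lemma compresses_restricted (pi : spectrum B) (rho : spectrum A) x :
  is_induced X pi rho ->
  compresses rho pi (lip (ib_left X) x x)
    (fun b => lip (ib_left X) (ract (ib_right X) x b) x).
Proof.
move=> [t [[tlx tlh] t_bal t_hip t_dense t_rho]].
have adj := tensor_adjoint tlh t_hip x.
pose S k := sval (cid (adj k)).
have SE k h : hip (t x h) k = hip h (S k) := svalP (cid (adj k)) h.
exists S; split => [k k'|b k k']; rewrite -SE.
  by rewrite (tensor_of_adjoint t_bal t_hip t_dense t_rho x (SE k)).
by rewrite -t_bal (tensor_of_adjoint t_bal t_hip t_dense t_rho _ (SE k)).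
Qed.

Lemma unit_neq0 (H : hilbertType R) (h : H) : vnorm h = 1 -> h != 0.
Proof.
by move=> h1; apply/eqP => h0; have /eqP := h1; rewrite h0 vnorm0 eq_sym oner_eq0.
Qed.

Variables (I : Type) (pi : spectrum B) (rho : spectrum A).
Variables (pi_ : I -> spectrum B) (rho_ : I -> spectrum A).
Hypothesis ind : is_induced X pi rho.
Hypothesis ind_ : forall i, is_induced X (pi_ i) (rho_ i).
Variables (h0 : spec_space pi) (k0 : spec_space rho).
Hypothesis h01 : vnorm h0 = 1.
Hypothesis k01 : vnorm k0 = 1.

Lemma induced_approx (s : seq A) (e : R) : 0 < e ->
  exists (c : B) (beta : A -> B),
    [/\ cabs (vector_functional h0 c - 1) < e,
        forall a, a \in s -> cabs (vector_functional h0 (beta a)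
                                   - vector_functional k0 a) < e &
        forall i, compresses (pi_ i) (rho_ i) c beta].
Proof.
move=> e0; have [d d0 near] := vector_functional_near s k01 e0.
have [t [[tlx tlh] t_bal t_hip t_dense t_rho]] := ind.
have [_ [x _ <-] xd] := tensor_approximable tlx t_hip t_rho
  (spec_irr pi) (spec_irr rho) (unit_neq0 h01) k0 d0.
have [near1 near2] := near _ xd.
exists (rip (ib_right X) x x), (fun a => rip (ib_right X) x (lact (ib_left X) a x)).
split => [|a /near2|i]; last exact: compresses_induced.
  by rewrite /vector_functional -t_hip.
by rewrite /vector_functional -t_hip -t_rho.
Qed.

Lemma restricted_approx (s : seq B) (e : R) : 0 < e ->
  exists (c : A) (beta : B -> A),
    [/\ cabs (vector_functional k0 c - 1) < e,
        forall b, b \in s -> cabs (vector_functional k0 (beta b)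
                                   - vector_functional h0 b) < e &
        forall i, compresses (rho_ i) (pi_ i) c beta].
Proof.
move=> e0; have [d d0 near] := vector_functional_near s h01 e0.
have [t [[tlx tlh] t_bal t_hip t_dense t_rho]] := ind.
have [y [x yE] xd] := adjoint_approximable tlx tlh t_bal t_hip t_dense
  (spec_irr pi) (unit_neq0 k01) h0 d0.
have [near1 near2] := near _ xd.
have of_adj z := tensor_of_adjoint t_bal t_hip t_dense t_rho z yE.
exists (lip (ib_left X) x x), (fun b => lip (ib_left X) (ract (ib_right X) x b) x).
split => [|b /near2|i]; last exact: compresses_restricted.
  by rewrite /vector_functional -of_adj yE.
by rewrite /vector_functional -of_adj t_bal yE.
Qed.

End Induced.

Theorem theorem10 (R : realType) (A B : cstarAlgType R)
    (X : imprimitivityBimodule A B)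
    (I : Type) (le : I -> I -> Prop) (le_directed : directed_preorder le)
    (pi : spectrum B) (pi_ : I -> spectrum B)
    (Ind_pi : spectrum A) (Ind_pi_ : I -> spectrum A)
    (Ind_piE : is_induced X pi Ind_pi)
    (Ind_pi_E : forall i, is_induced X (pi_ i) (Ind_pi_ i))
    (pi_cluster : cluster_point le pi_ pi)
    (phi : B -> R[i]) (psi : A -> R[i])
    (phi_pure : pure_state phi) (phi_pi : associated pi phi)
    (psi_pure : pure_state psi) (psi_Ind_pi : associated Ind_pi psi) :
  upper_mult le phi pi_ = upper_mult le psi Ind_pi_.
Proof.
have [_ le_refl _ _] := le_directed.
have [h h1 phiE] := phi_pi; have [k k1 psiE] := psi_Ind_pi.
have {}h1 : vnorm h = 1 by rewrite /vnorm h1.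
have {}k1 : vnorm k = 1 by rewrite /vnorm k1.
move: phi_pure psi_pure; rewrite phiE psiE => h_pure k_pure.
apply/eqP; rewrite eq_le; apply/andP; split.
  by apply: transfer_upper_mult => //; exact: (induced_approx Ind_piE Ind_pi_E h1 k1).
by apply: transfer_upper_mult => //; exact: (restricted_approx Ind_piE Ind_pi_E h1 k1).
Qed.
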